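(* There exist infinitely many commensurability classes of pseudomodular groups and of pseudomodular surfaces.
   Context: $\mathrm{PSL}(2,\mathbb{R})$ acts on the upper half plane $\mathbb{H}^2$ by orientation-preserving isometries; elements of $\mathrm{PGL}(2,\mathbb{Q})$ of positive determinant are regarded as elements of $\mathrm{PSL}(2,\mathbb{R})$ after rescaling. The cusp set of a Fuchsian group $\Gamma\le \mathrm{PSL}(2,\mathbb{R})$ is the set of all $x\in\mathbb{R}\cup\{\infty\}=\partial\mathbb{H}^2$ whose stabilizer in $\Gamma$ is generated by a parabolic element. Let $\Gamma\le\mathrm{PGL}(2,\mathbb{Q})$ be a discrete group such that $\mathbb{H}^2/\Gamma$ is a complete hyperbolic surface (cone points allowed, i.e. an orbifold) of finite area. If $\Gamma$ is not commensurable with $\mathrm{PSL}(2,\mathbb{Z})$ and the cusp set of $\Gamma$ is precisely $\mathbb{Q}\cup\{\infty\}$, then $\Gamma$ is called a pseudomodular group and $\mathbb{H}^2/\Gamma$ a pseudomodular surface. Commensurability is in the wide sense: $\Gamma_1,\Gamma_2$ are commensurable if for some $g\in\mathrm{PSL}(2,\mathbb{R})$ the group $g\Gamma_1g^{-1}\cap\Gamma_2$ has finite index in both $g\Gamma_1g^{-1}$ and $\Gamma_2$. Surfaces are commensurable if their groups are. *)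

(* Defs.v *)
From HB Require Import structures.
From mathcomp Require Import all_boot all_order all_algebra.
From mathcomp Require Import complex.
From mathcomp Require Import all_classical all_reals all_analysis.

Set Implicit Arguments.
Unset Strict Implicit.
Unset Printing Implicit Defensive.

Import Order.TTheory GRing.Theory Num.Theory.
Import numFieldNormedType.Exports.

Local Open Scope classical_set_scope.
Local Open Scope ring_scope.
Local Open Scope complex_scope.
Local Open Scope quotient_scope.

Section AbstractGroups.
Variable gT : groupType.
Implicit Types (G K : set gT) (x : gT).

Definition is_subgroup G : Prop :=
  [/\ G 1%g, (forall x y, G x -> G y -> G (x * y)%g)
    & forall x, G x -> G (x^-1)%g].

Definition cyclic_subgroup x : set gT :=
  [set y | exists n : nat, y = (x ^+ n)%g \/ y = (x ^- n)%g].

Definition conj_subgroup x G : set gT := [set (x * y * x^-1)%g | y in G].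

Definition left_cosets G K : set (set gT) :=
  [set [set (x * k)%g | k in K] | x in G].

Definition has_finite_index K G : Prop := finite_set (left_cosets G K).

Definition commensurable G1 G2 : Prop :=
  exists g, let K := conj_subgroup g G1 `&` G2 in
    has_finite_index K (conj_subgroup g G1) /\ has_finite_index K G2.

End AbstractGroups.

Section SL2.
Variable R : realType.

Record SL2 := MkSL2 { SL2val :> 'M[R]_2; _ : \det SL2val == 1 }.

HB.instance Definition _ := [isSub for SL2val].
HB.instance Definition _ := [Choice of SL2 by <:].

Lemma SL2P (A : SL2) : \det (val A) = 1.
Proof. exact/eqP/(valP A). Qed.

Lemma SL2_unit (A : SL2) : val A \in unitmx.
Proof. by rewrite unitmxE SL2P unitr1. Qed.

Fact SL2_one_subproof : \det (1%:M : 'M[R]_2) == 1.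
Proof. by rewrite det1. Qed.
Definition SL2_one := MkSL2 SL2_one_subproof.

Fact SL2_mul_subproof (A B : SL2) : \det (val A *m val B) == 1.
Proof. by rewrite det_mulmx !SL2P mulr1. Qed.
Definition SL2_mul A B := MkSL2 (SL2_mul_subproof A B).

Fact SL2_inv_subproof (A : SL2) : \det (invmx (val A)) == 1.
Proof. by rewrite det_inv SL2P invr1. Qed.
Definition SL2_inv A := MkSL2 (SL2_inv_subproof A).

Fact SL2_mulA : associative SL2_mul.
Proof. by move=> A B C; apply/val_inj; rewrite /= mulmxA. Qed.
Fact SL2_mul1 : left_id SL2_one SL2_mul.
Proof. by move=> A; apply/val_inj; rewrite /= mul1mx. Qed.
Fact SL2_mulr1 : right_id SL2_one SL2_mul.
Proof. by move=> A; apply/val_inj; rewrite /= mulmx1. Qed.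
Fact SL2_mulV : left_inverse SL2_one SL2_inv SL2_mul.
Proof. by move=> A; apply/val_inj; rewrite /= mulVmx ?SL2_unit. Qed.
Fact SL2_mulrV : right_inverse SL2_one SL2_inv SL2_mul.
Proof. by move=> A; apply/val_inj; rewrite /= mulmxV ?SL2_unit. Qed.

HB.instance Definition _ :=
  isGroup.Build SL2 SL2_mulA SL2_mul1 SL2_mulr1 SL2_mulV SL2_mulrV.

HB.instance Definition _ :=
  Topological.copy SL2 (initial_topology (SL2val : SL2 -> 'M[R]_2)).

Definition SL2_pm (A B : SL2) : bool :=
  (val A == val B) || (val A == - val B).

Fact SL2_pm_equiv : equiv_class_of SL2_pm.
Proof.
split=> [A|A B|B A C]; rewrite /SL2_pm ?eqxx //.
  by rewrite [val B == _]eq_sym [val B == - _]eq_sym eqr_oppLR.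
case/orP=> /eqP-> /orP[]/eqP->; rewrite ?opprK ?eqxx ?orbT //.
Qed.
Canonical SL2_pm_rel := EquivRelPack SL2_pm_equiv.

Definition PSL2 := quotient_topology {eq_quot SL2_pm}.
HB.instance Definition _ := Quotient.on PSL2.
HB.instance Definition _ := Topological.on PSL2.

Definition toPSL2 (A : SL2) : PSL2 := \pi_(quotient_topology {eq_quot SL2_pm}) A.

Lemma toPSL2_eqP (A B : SL2) :
  reflect (val A = val B \/ val A = - val B) (toPSL2 A == toPSL2 B).
Proof.
have -> : (toPSL2 A == toPSL2 B) = SL2_pm A B.
  apply/eqP/idP => [h|h]; first exact/(@eqmodP _ SL2_pm_rel A B).
  exact: (@eqmodP _ SL2_pm_rel A B h).
by apply: (iffP orP) => -[] /eqP; by [left|right].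
Qed.

Lemma reprPSL2K (g : PSL2) : toPSL2 (repr g) = g.
Proof. exact: reprK. Qed.

Lemma repr_toPSL2 (A : SL2) :
  val (repr (toPSL2 A)) = val A \/ val (repr (toPSL2 A)) = - val A.
Proof. by apply/toPSL2_eqP; rewrite reprPSL2K. Qed.

Definition PSL2_one : PSL2 := toPSL2 1%g.
Definition PSL2_mul (g h : PSL2) : PSL2 := toPSL2 (repr g * repr h)%g.
Definition PSL2_inv (g : PSL2) : PSL2 := toPSL2 (repr g)^-1%g.

Lemma toPSL2M (A B : SL2) : PSL2_mul (toPSL2 A) (toPSL2 B) = toPSL2 (A * B)%g.
Proof.
apply/eqP/toPSL2_eqP => /=.
case: (repr_toPSL2 A) (repr_toPSL2 B) => /= -> [] /= ->;
  rewrite ?mulmxN ?mulNmx ?opprK; by [left|right].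
Qed.

Lemma toPSL2V (A : SL2) : PSL2_inv (toPSL2 A) = toPSL2 (A^-1)%g.
Proof.
apply/eqP/toPSL2_eqP => /=; case: (repr_toPSL2 A) => /= ->; first by left.
right; rewrite -scaleN1r invmxZ; last by rewrite unitmxZ ?SL2_unit ?unitrN1.
by rewrite invrN1 scaleN1r.
Qed.

Fact PSL2_mulA : associative PSL2_mul.
Proof.
move=> f g h; rewrite -[f]reprPSL2K -[g]reprPSL2K -[h]reprPSL2K.
by rewrite !toPSL2M mulgA.
Qed.
Fact PSL2_mul1 : left_id PSL2_one PSL2_mul.
Proof. by move=> g; rewrite -[g]reprPSL2K toPSL2M mul1g. Qed.
Fact PSL2_mulr1 : right_id PSL2_one PSL2_mul.
Proof. by move=> g; rewrite -[g]reprPSL2K toPSL2M mulg1. Qed.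
Fact PSL2_mulV : left_inverse PSL2_one PSL2_inv PSL2_mul.
Proof. by move=> g; rewrite -[g]reprPSL2K toPSL2V toPSL2M mulVg. Qed.
Fact PSL2_mulrV : right_inverse PSL2_one PSL2_inv PSL2_mul.
Proof. by move=> g; rewrite -[g]reprPSL2K toPSL2V toPSL2M mulgV. Qed.

HB.instance Definition _ :=
  isGroup.Build PSL2 PSL2_mulA PSL2_mul1 PSL2_mulr1 PSL2_mulV PSL2_mulrV.

End SL2.

Section Hyperbolic.
Variable R : realType.
Implicit Types (A : 'M[R]_2) (g : PSL2 R) (G : set (PSL2 R)).

Definition upper_half_plane : set R[i] := [set z | 0 < complex.Im z].

Definition mobius A (z : R[i]) : R[i] :=
  ((A 0 0)%:C * z + (A 0 1)%:C) / ((A 1 0)%:C * z + (A 1 1)%:C).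

Definition act g (z : R[i]) : R[i] := mobius (val (repr g)) z.

(* The boundary of the half plane is [option R], [None] being infinity. *)
Definition bmobius A (x : option R) : option R :=
  match x with
  | Some t => if A 1 0 * t + A 1 1 == 0 then None
              else Some ((A 0 0 * t + A 0 1) / (A 1 0 * t + A 1 1))
  | None => if A 1 0 == 0 then None else Some (A 0 0 / A 1 0)
  end.

Definition bact g (x : option R) : option R := bmobius (val (repr g)) x.

Lemma mobiusN A z : mobius (- A) z = mobius A z.
Proof.
by rewrite /mobius !mxE !rmorphN /= !mulNr -!opprD invrN mulrNN.
Qed.

Lemma bmobiusN A x : bmobius (- A) x = bmobius A x.
Proof.
case: x => [t|] /=; rewrite !mxE.
  by rewrite !mulNr -!opprD oppr_eq0 invrN mulrNN.
by rewrite oppr_eq0 invrN mulrNN.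
Qed.

Lemma act_toPSL2 (A : SL2 R) z : act (toPSL2 A) z = mobius (val A) z.
Proof. by rewrite /act; case: (repr_toPSL2 A) => -> //; rewrite mobiusN. Qed.

Lemma bact_toPSL2 (A : SL2 R) x : bact (toPSL2 A) x = bmobius (val A) x.
Proof. by rewrite /bact; case: (repr_toPSL2 A) => -> //; rewrite bmobiusN. Qed.

(* Only the square of the trace is well defined on PSL(2,R). *)
Definition parabolic g : Prop := g <> 1%g /\ (\tr (val (repr g))) ^+ 2 = 4.

Definition discrete G : Prop := G `<=` isolated G.

Definition fuchsian G : Prop := is_subgroup G /\ discrete G.

Definition cusp_stabilizer G (x : option R) : set (PSL2 R) :=
  [set g | G g /\ bact g x = x].

Definition cusp_set G : set (option R) :=
  [set x | exists2 p, parabolic p & cusp_stabilizer G x = cyclic_subgroup p].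

Definition rational_cusps : set (option R) :=
  [set x | x = None \/ exists q : rat, x = Some (ratr q)].

Definition plane_set (F : set R[i]) : set (R * R) :=
  [set p | F (p.1 +i* p.2)].

Definition hyp_area (F : set R[i]) : \bar R :=
  (\int[lebesgue_measure \x lebesgue_measure]_(p in plane_set F)
     (p.2 ^- 2)%:E)%E.

Definition fundamental_domain G (F : set R[i]) : Prop :=
  [/\ F `<=` upper_half_plane, measurable (plane_set F),
      upper_half_plane `<=` \bigcup_(g in G) (act g @` F)
    & forall g, G g -> g <> 1%g -> hyp_area (act g @` F `&` F) = 0%E].

(* The area of the quotient of the half plane by a Fuchsian group is the area
   of any fundamental domain. *)
Definition finite_area G : Prop :=
  exists2 F, fundamental_domain G F & (hyp_area F < +oo)%E.

(* The orientation-preserving part of PGL(2,Q), inside PSL(2,R). *)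
Definition PGL2Q : set (PSL2 R) :=
  [set g | exists (B : 'M[rat]_2) (A : SL2 R), [/\ 0 < \det B,
     val A = (Num.sqrt (ratr (\det B)))^-1 *: map_mx ratr B & g = toPSL2 A]].

Definition PSL2Z : set (PSL2 R) :=
  [set g | exists (B : 'M[int]_2) (A : SL2 R),
     [/\ \det B = 1, val A = map_mx intr B & g = toPSL2 A]].

Definition pseudomodular_group G : Prop :=
  [/\ G `<=` PGL2Q, fuchsian G, finite_area G,
      ~ commensurable G PSL2Z & cusp_set G = rational_cusps].

(* The quotient of the half plane by G, as the partition into orbits; its
   hyperbolic orbifold structure is the one inherited from the half plane. *)
Definition quotient_surface G : set (set R[i]) :=
  [set [set act g z | g in G] | z in upper_half_plane].

Definition pseudomodular_surface (X : set (set R[i])) : Prop :=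
  exists2 G, pseudomodular_group G & X = quotient_surface G.

Definition commensurable_surfaces (X Y : set (set R[i])) : Prop :=
  exists G1 G2, [/\ fuchsian G1 /\ X = quotient_surface G1,
                    fuchsian G2 /\ Y = quotient_surface G2
                  & commensurable G1 G2].

Definition pseudomodular_group_class G : set (set (PSL2 R)) :=
  [set G' | pseudomodular_group G' /\ commensurable G G'].

Definition pseudomodular_surface_class X : set (set (set R[i])) :=
  [set X' | pseudomodular_surface X' /\ commensurable_surfaces X X'].

End Hyperbolic.

(* Main.v *)
Require Import Defs.
From mathcomp Require Import all_boot all_order all_algebra.
From mathcomp Require Import complex ring lra.
From mathcomp Require Import all_classical all_reals all_analysis.
From mathcomp Require Import measurable_realfun.

Set Implicit Arguments.
Unset Strict Implicit.
Unset Printing Implicit Defensive.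

Import Order.TTheory GRing.Theory Num.Theory.
Import numFieldNormedType.Exports.

Local Open Scope classical_set_scope.
Local Open Scope ring_scope.

(** The theorem holds because there is an explicit family of pseudomodular
    groups, one for each prime p, in which the p-adic behaviour of traces tells
    the members apart.

    For n > 0 let P be the ideal polygon with vertices oo, 0, 1, ..., n, and let
    Gamma_n be generated by one involution for each edge of P, exchanging the
    ends of that edge. On the edge from j to j + 1 it is the half turn about the
    midpoint used by PSL(2,Z); on the two vertical edges the fixed point is
    raised from height 1 to height sqrt n, so that [gen_mx] has determinant n
    there. The two shears cancel around the vertices, so the product of all the
    involutions is a translation ([around_infinity]).

    Ping-pong on the half planes beyond the edges ([side_disjoint], [pingpong])
    makes Gamma_n discrete, with the translates of P not overlapping.

    Every rational is a cusp by a Euclidean algorithm ([cuspidal_fraction]). In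
    the coordinate y = x / n, the group contains y |-> m - 1 / (y - m) for the
    odd integers m of [- 2 n, 0], and a translate of y |-> - 1 / (n y - j) for
    0 <= j <= n. The former lowers the denominators of the rationals at distance
    less than 1 from m, the latter those of the rationals between j / n and
    (j + 1) / n, and the even integers of [- 2 n, 0] are images of oo. Together
    they take care of [- 2 n, 1), which is a whole period. It matters here that
    P consists of n Farey triangles meeting at oo: the strip [0, n] thus has an
    integral width in the coordinate y.

    That the translates of P cover the half plane, which is completeness of the
    quotient, follows from the cusp set ([polygon_covers]): a point
    outside all translates would lie in an infinite nested sequence of half
    planes, these would all contain a common rational in their boundary
    interval, and a rational, being the image of oo under a finite word, lies in
    finitely many of them. The polygon is therefore a fundamental domain, of
    finite area, and the stabilizer of oo is generated by the translation found
    above.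

    If two groups are commensurable, some power of each element of the first is
    conjugate to an element of the second ([commensurable_power]), and
    conjugation preserves squared traces. The product of the involutions of the
    edges (oo, 0) and (0, 1) has powers with squared trace m ^ 2 / p ^ k, m prime
    to p ([power_trace]), while in Gamma_r the denominators are powers of r and
    in PSL(2,Z) they are 1. Hence the groups Gamma_p are pairwise
    incommensurable and none is commensurable with PSL(2,Z).

    For surfaces, a countable group is determined by its orbits in the half
    plane ([countable_group_orbits]), so that commensurability of the quotients
    is commensurability of the groups. *)

(** * Real matrices as elements of PSL(2,R) *)

Lemma ord2_cases (i : 'I_2) : i = 0 \/ i = 1.
Proof. by case: i => [[|[|i]] hi]; [left|right|]; try exact/val_inj. Qed.

Lemma sum_ord2 (V : nmodType) (F : 'I_2 -> V) : \sum_(i < 2) F i = F 0 + F 1.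
Proof.
rewrite !big_ord_recl big_ord0 addr0.
by congr (F _ + F _); apply/val_inj.
Qed.

Section TwoByTwo.
Variable T : comNzRingType.
Implicit Types (a b c d : T) (A B : 'M[T]_2).

Definition mx2 a b c d : 'M[T]_2 :=
  \matrix_(i, j) if i == 0 then (if j == 0 then a else b)
                 else (if j == 0 then c else d).

Lemma mx2E a b c d :
  (mx2 a b c d 0 0 = a) * (mx2 a b c d 0 1 = b) *
  (mx2 a b c d 1 0 = c) * (mx2 a b c d 1 1 = d).
Proof. by rewrite /mx2 !mxE. Qed.

Lemma mx2_eta A : A = mx2 (A 0 0) (A 0 1) (A 1 0) (A 1 1).
Proof.
apply/matrixP=> i j; rewrite mxE.
by case: (ord2_cases i) => ->; case: (ord2_cases j) => ->.
Qed.

Lemma mulmx2E A B i j : (A *m B) i j = A i 0 * B 0 j + A i 1 * B 1 j.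
Proof. by rewrite mxE sum_ord2. Qed.

Lemma mulmx2 a b c d a' b' c' d' :
  mx2 a b c d *m mx2 a' b' c' d' =
  mx2 (a * a' + b * c') (a * b' + b * d') (c * a' + d * c') (c * b' + d * d').
Proof. by rewrite [LHS]mx2_eta !mulmx2E !mx2E. Qed.

Lemma scalemx2 k a b c d : k *: mx2 a b c d = mx2 (k * a) (k * b) (k * c) (k * d).
Proof. by rewrite [LHS]mx2_eta !mxE. Qed.

Lemma det2E A : \det A = A 0 0 * A 1 1 - A 0 1 * A 1 0.
Proof.
rewrite (expand_det_row _ 0) sum_ord2 /cofactor !det_mx11 !mxE /=.
rewrite expr0 mul1r add0n expr1 mulN1r mulrN.
by congr (_ * A _ _ - _ * A _ _); apply/val_inj.
Qed.

Lemma det2 a b c d : \det (mx2 a b c d) = a * d - b * c.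
Proof. by rewrite det2E !mx2E. Qed.

Lemma tr2E A : \tr A = A 0 0 + A 1 1.
Proof. exact: sum_ord2. Qed.

End TwoByTwo.

Section Normalize.
Variable R : realType.
Implicit Types (A B : 'M[R]_2) (g h : PSL2 R).

(** Rescaling embeds the matrices of positive determinant, up to scalars, in
    PSL(2); the default [1] is the value at the other matrices. *)
Definition psl A : PSL2 R :=
  toPSL2 (insubd (1%g : SL2 R) ((Num.sqrt (\det A))^-1 *: A)).

Lemma val_psl A : 0 < \det A ->
  val (insubd (1%g : SL2 R) ((Num.sqrt (\det A))^-1 *: A)) =
  (Num.sqrt (\det A))^-1 *: A.
Proof.
move=> dA; rewrite val_insubd; case: ifPn => // /eqP[].
by rewrite detZ exprVn sqr_sqrtr ?ltW// mulVf// gt_eqF.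
Qed.

Lemma psl_repr g : psl (val (repr g)) = g.
Proof.
rewrite /psl SL2P sqrtr1 invr1 scale1r.
by rewrite -[RHS]reprPSL2K; congr toPSL2; exact: valKd.
Qed.

Lemma det_repr g : \det (val (repr g)) = 1.
Proof. exact: SL2P. Qed.

Lemma repr_psl A : 0 < \det A -> exists2 k, k ^+ 2 = (\det A)^-1 &
  val (repr (psl A)) = k *: A.
Proof.
move=> dA; set s := Num.sqrt (\det A).
have s2 : s ^- 1 ^+ 2 = (\det A)^-1 by rewrite exprVn sqr_sqrtr ?ltW.
case: (repr_toPSL2 (insubd (1%g : SL2 R) (s^-1 *: A))) => e.
  by exists s^-1 => //; rewrite e val_psl.
by exists (- s^-1); rewrite ?sqrrN// e val_psl// scaleNr.
Qed.

Lemma pslM A B : 0 < \det A -> 0 < \det B -> psl (A *m B) = (psl A * psl B)%g.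
Proof.
move=> dA dB; rewrite [RHS]toPSL2M; congr toPSL2; apply/val_inj.
have dAB : 0 < \det (A *m B) by rewrite det_mulmx mulr_gt0.
rewrite val_psl//= !val_psl// det_mulmx sqrtrM ?ltW// invfM.
by rewrite -scalemxAl -scalemxAr scalerA.
Qed.

Lemma psl1 : psl 1%:M = 1%g.
Proof.
rewrite /psl det1 sqrtr1 invr1 scale1r; congr toPSL2.
by apply/val_inj; rewrite val_insubd det1 eqxx.
Qed.

Lemma pslZ k A : k != 0 -> 0 < \det A -> psl (k *: A) = psl A.
Proof.
move=> k0 dA; apply/eqP/toPSL2_eqP.
have dkA : 0 < \det (k *: A) by rewrite detZ mulr_gt0 ?exprn_even_gt0.
rewrite !val_psl// detZ sqrtrM ?sqr_ge0// sqrtr_sqr scalerA invfM mulrAC.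
case: (ltgtP k 0) k0 => // hk _; last first.
  by left; rewrite gtr0_norm// mulVf ?gt_eqF// mul1r.
by right; rewrite ltr0_norm// invrN mulNr mulVf ?lt_eqF// mulN1r scaleNr.
Qed.

Lemma psl_scalar k : k != 0 -> psl (mx2 k 0 0 k) = 1%g.
Proof.
move=> k0; rewrite -psl1 -(@pslZ k 1%:M) ?det1//; congr psl.
by rewrite [RHS]mx2_eta !mxE /= !mulr1n !mulr0n !mulr1 !mulr0.
Qed.

End Normalize.

(** * Points of the closed half plane as positive symmetric matrices *)

Section Cone.
Variable R : realType.
Implicit Types (A B : 'M[R]_2) (g h : PSL2 R) (p q : R * R * R).
Implicit Types (z : R[i]) (x : option R).

(** The closed half plane is the projectivization of the cone of positive
    semidefinite symmetric matrices: a triple (s, t, w) stands for the matrix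
    with rows (s, t) and (t, w), and boundary points are the matrices of rank
    one. In this model half planes are linear inequalities, so that statements
    about points and about cusps have a common proof. *)
Definition scale3 (k : R) p := (k * p.1.1, k * p.1.2, k * p.2).

Definition point_of_H z : R * R * R :=
  (complex.Re z ^+ 2 + complex.Im z ^+ 2, complex.Re z, 1).

Definition point_of_boundary x : R * R * R :=
  if x is Some t then (t ^+ 2, t, 1) else (1, 0, 0).

Definition cone p : Prop := [/\ 0 <= p.1.1, 0 <= p.2 & p.1.2 ^+ 2 <= p.1.1 * p.2].

(** The entries of the congruence [A S A^T] of the symmetric matrix [S]. *)
Definition mxact A p : R * R * R :=
  (A 0 0 ^+ 2 * p.1.1 + 2 * A 0 0 * A 0 1 * p.1.2 + A 0 1 ^+ 2 * p.2,
   A 0 0 * A 1 0 * p.1.1 + (A 0 0 * A 1 1 + A 0 1 * A 1 0) * p.1.2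
     + A 0 1 * A 1 1 * p.2,
   A 1 0 ^+ 2 * p.1.1 + 2 * A 1 0 * A 1 1 * p.1.2 + A 1 1 ^+ 2 * p.2).

Definition gact g p := mxact (val (repr g)) p.

Lemma scale3A k l p : scale3 k (scale3 l p) = scale3 (k * l) p.
Proof. by rewrite /scale3 /= !mulrA. Qed.

Lemma scale31 p : scale3 1 p = p.
Proof. by case: p => -[s t] w; rewrite /scale3 /= !mul1r. Qed.

Lemma mxactM A B p : mxact (A *m B) p = mxact A (mxact B p).
Proof. by rewrite /mxact !mulmx2E /=; congr (_, _, _); ring. Qed.

Lemma mxactZ k A p : mxact (k *: A) p = scale3 (k ^+ 2) (mxact A p).
Proof. by rewrite /mxact /scale3 !mxE /=; congr (_, _, _); ring. Qed.

Lemma mxact_scale3 k A p : mxact A (scale3 k p) = scale3 k (mxact A p).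
Proof. by rewrite /mxact /scale3 /=; congr (_, _, _); ring. Qed.

Lemma gact_scale3 k g p : gact g (scale3 k p) = scale3 k (gact g p).
Proof. exact: mxact_scale3. Qed.

Lemma gact_psl A p : 0 < \det A -> gact (psl A) p = scale3 (\det A)^-1 (mxact A p).
Proof. by move=> dA; rewrite /gact; have [k k2 ->] := repr_psl dA; rewrite mxactZ k2. Qed.

Lemma gactM g h p : gact (g * h)%g p = gact g (gact h p).
Proof.
rewrite -{1}[g]psl_repr -{1}[h]psl_repr -pslM ?det_repr// gact_psl;
  rewrite det_mulmx !det_repr ?mulr1// invr1 scale31.
exact: mxactM.
Qed.

Lemma gact1 p : gact 1%g p = p.
Proof.
rewrite -psl1 gact_psl det1// invr1 scale31 /mxact !mxE /=.
by case: p => -[s t] w /=; congr (_, _, _); ring.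
Qed.

(** The determinant of the symmetric matrix is multiplied by a square, and its
    diagonal entries remain values of the same positive quadratic form. *)
Lemma cone_mxact A p : cone p -> cone (mxact A p).
Proof.
move=> [s0 w0 tsw].
have sq (a b : R) : 0 <= a ^+ 2 * p.1.1 + 2 * a * b * p.1.2 + b ^+ 2 * p.2.
  have [sp|] := ltP 0 p.1.1.
    rewrite -(pmulr_rge0 _ sp).
    have -> : p.1.1 * (a ^+ 2 * p.1.1 + 2 * a * b * p.1.2 + b ^+ 2 * p.2) =
      (a * p.1.1 + b * p.1.2) ^+ 2 + b ^+ 2 * (p.1.1 * p.2 - p.1.2 ^+ 2) by ring.
    by rewrite addr_ge0 ?sqr_ge0// mulr_ge0 ?sqr_ge0// subr_ge0.
  move=> sn; have s_0 : p.1.1 = 0 by apply/eqP; rewrite eq_le sn s0.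
  move: tsw; rewrite s_0 mul0r => t0.
  have -> : p.1.2 = 0 by apply/eqP; rewrite -sqrf_eq0 eq_le t0 sqr_ge0.
  by rewrite !mulr0 !add0r mulr_ge0 ?sqr_ge0.
split; [exact: sq|exact: sq|rewrite /= -subr_ge0].
set l := (X in 0 <= X).
have -> : l = (A 0 0 * A 1 1 - A 0 1 * A 1 0) ^+ 2 * (p.1.1 * p.2 - p.1.2 ^+ 2).
  by rewrite /l; ring.
by rewrite mulr_ge0 ?sqr_ge0// subr_ge0.
Qed.

Lemma cone_gact g p : cone p -> cone (gact g p).
Proof. exact: cone_mxact. Qed.

Lemma cone_point_of_H z : cone (point_of_H z).
Proof.
split => //=; first by rewrite addr_ge0 ?sqr_ge0.
by rewrite mulr1 lerDl sqr_ge0.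
Qed.

Lemma cone_point_of_boundary x : cone (point_of_boundary x).
Proof. by case: x => [t|]; split => //=; rewrite ?sqr_ge0 ?mulr1 ?mulr0 ?expr0n. Qed.

Lemma point_of_H_inj k z z' : 0 < complex.Im z -> 0 < complex.Im z' ->
  point_of_H z = scale3 k (point_of_H z') -> z = z'.
Proof.
case: z z' => [u v] [u' v']; rewrite /point_of_H /scale3 /= => v0 v'0 [].
rewrite mulr1 => + + k1; rewrite -k1 !mul1r => + euu'; rewrite -euu'.
move=> /addrI/eqP; rewrite eqf_sqr => /orP[/eqP->//|/eqP vv'].
by move: v0; rewrite vv' oppr_gt0 ltNge ltW.
Qed.

Lemma point_of_boundary_inj k x y :
  point_of_boundary x = scale3 k (point_of_boundary y) -> x = y.
Proof.
case: x y => [t|] [t'|] //; rewrite /scale3 /= => -[].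
- by rewrite mulr1 => _ + k1; rewrite -k1 mul1r => ->.
- by rewrite mulr0 => _ _ /eqP; rewrite oner_eq0.
- by rewrite mulr1 => + _ k0; rewrite -k0 mul0r => /eqP; rewrite oner_eq0.
Qed.

(** A point of the half plane is proportional to the symmetric matrix
    [v v^* ] of the vector v = (z, 1), with real parts taken entrywise, so
    fractional linear maps become congruences up to a positive factor. *)
Lemma gact_point_of_H g z : 0 < complex.Im z ->
  0 < complex.Im (act g z) /\
  exists2 k, 0 < k & gact g (point_of_H z) = scale3 k (point_of_H (act g z)).
Proof.
rewrite /act /gact; have := det_repr g; move: (val (repr g)) => A.
rewrite det2E /mxact /mobius /point_of_H /scale3.
move: (A 0 0) (A 0 1) (A 1 0) (A 1 1) => a b c d {A g} dA.
case: z => u v /= v0; rewrite !mul0r !subr0 !addr0.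
have [N eN] : {N | N = (c * u + d) ^+ 2 + (c * v) ^+ 2} by eexists.
rewrite -eN.
have N0 : 0 < N.
  rewrite eN; have [c0|c0] := eqVneq c 0.
    rewrite c0 !mul0r expr0n addr0 add0r exprn_even_gt0//=.
    by apply/eqP=> d0; move/eqP: dA; rewrite c0 d0 !mulr0 subr0 eq_sym oner_eq0.
  by rewrite ltr_wpDl ?sqr_ge0// exprn_even_gt0//= mulf_neq0// gt_eqF.
have N'0 : N != 0 by rewrite gt_eqF.
set Y := (Y in 0 < Y); have eY : Y = (a * d - b * c) * v / N.
  by rewrite /Y; field.
split; first by rewrite eY dA mul1r divr_gt0.
exists N => //.
set X := (X in (_, N * X, _)).
have eX : X = ((a * u + b) * (c * u + d) + a * c * v ^+ 2) / N.
  by rewrite /X; field.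
rewrite -[in RHS]/X -[in RHS]/Y.
have e2 : X ^+ 2 + Y ^+ 2 = ((a * u + b) ^+ 2 + (a * v) ^+ 2) / N.
  apply: (@mulIf _ (N ^+ 2)); first by rewrite expf_neq0.
  transitivity (((a * u + b) ^+ 2 + (a * v) ^+ 2) * N); last by field.
  by rewrite [in RHS]eN eX eY; field.
congr (_, _, _); last by rewrite eN; ring.
  by rewrite e2; field.
by rewrite eX; field.
Qed.

Lemma gact_point_of_boundary g x : exists2 k, 0 < k &
  gact g (point_of_boundary x) = scale3 k (point_of_boundary (bact g x)).
Proof.
rewrite /bact /gact; have := det_repr g; move: (val (repr g)) => A.
rewrite det2E /mxact /scale3; case: x => [t|] /=;
  move: (A 0 0) (A 0 1) (A 1 0) (A 1 1) => a b c d dA.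
  case: eqP => [e|/eqP ctd0] /=; last first.
    exists ((c * t + d) ^+ 2); first by rewrite exprn_even_gt0.
    by congr (_, _, _); field.
  have atb0 : a * t + b != 0.
    apply/eqP=> atb; move/eqP: dA; apply/negP; rewrite eq_sym.
    have -> : a * d - b * c = a * (c * t + d) - c * (a * t + b) by ring.
    by rewrite e atb !mulr0 subr0 oner_eq0.
  exists ((a * t + b) ^+ 2); first by rewrite exprn_even_gt0.
  congr (_, _, _); rewrite ?mulr0 ?mulr1; [by ring| |].
    by transitivity ((a * t + b) * (c * t + d)); [ring|rewrite e mulr0].
  by transitivity ((c * t + d) ^+ 2); [ring|rewrite e expr0n].
case: eqP => [c0|/eqP c0] /=.
  exists (a ^+ 2); last by rewrite c0; congr (_, _, _); ring.
  rewrite exprn_even_gt0//=; apply/eqP=> a0; move/eqP: dA.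
  by rewrite a0 c0 mul0r mulr0 subr0 eq_sym oner_eq0.
by exists (c ^+ 2); [rewrite exprn_even_gt0|congr (_, _, _); field].
Qed.

Lemma actM g h z : 0 < complex.Im z -> act (g * h)%g z = act g (act h z).
Proof.
move=> z0; have [hz0 [k k0 ek]] := gact_point_of_H h z0.
have [ghz0 [l l0 el]] := gact_point_of_H g hz0.
have [ghz0' [m m0 em]] := gact_point_of_H (g * h)%g z0.
apply: (@point_of_H_inj (m^-1 * (k * l))) => //.
move: em; rewrite gactM ek gact_scale3 el scale3A => em.
by rewrite -scale3A em scale3A mulVf ?gt_eqF// scale31.
Qed.

Lemma act1 z : 0 < complex.Im z -> act 1%g z = z.
Proof.
move=> z0; have [hz0 [k k0 ek]] := gact_point_of_H 1%g z0.
apply: (@point_of_H_inj k^-1) => //; rewrite -[point_of_H z]gact1 ek.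
by rewrite scale3A mulVf ?gt_eqF// scale31.
Qed.

Lemma bactM g h x : bact (g * h)%g x = bact g (bact h x).
Proof.
have [k k0 ek] := gact_point_of_boundary h x.
have [l l0 el] := gact_point_of_boundary g (bact h x).
have [m m0 em] := gact_point_of_boundary (g * h)%g x.
apply: (@point_of_boundary_inj (m^-1 * (k * l))).
move: em; rewrite gactM ek gact_scale3 el scale3A => em.
by rewrite -scale3A em scale3A mulVf ?gt_eqF// scale31.
Qed.

Lemma bact1 x : bact (1%g : PSL2 R) x = x.
Proof.
have [k k0 ek] := gact_point_of_boundary 1%g x.
apply: (@point_of_boundary_inj k^-1); rewrite -[point_of_boundary x]gact1 ek.
by rewrite scale3A mulVf ?gt_eqF// scale31.
Qed.

Lemma bmobiusZ k A x : k != 0 -> bmobius (k *: A) x = bmobius A x.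
Proof.
move=> k0; case: x => [t|] /=; rewrite !mxE.
  by rewrite -!mulrA -!mulrDr mulf_eq0 (negPf k0) /= -mulf_div divff// mul1r.
by rewrite mulf_eq0 (negPf k0) /= -mulf_div divff// mul1r.
Qed.

Lemma bact_psl A x : 0 < \det A -> bact (psl A) x = bmobius A x.
Proof.
move=> dA; rewrite /bact; have [k k2 ->] := repr_psl dA; apply: bmobiusZ.
by apply/eqP=> k0; move/esym/eqP: k2; rewrite k0 expr0n/= invr_eq0 gt_eqF.
Qed.

End Cone.

(** * The polygon, its edge involutions, and the group they generate *)

Section Polygon.
Variables (R : realType) (n : nat).
Implicit Types (p : R * R * R) (g : PSL2 R).

(** Edges of the ideal polygon with vertices oo, 0, 1, ..., n: [None] joins oo
    to 0, [Some None] joins n to oo and [Some (Some j)] joins j to j + 1. *)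
Definition edge := option (option 'I_n).
Implicit Types (e f : edge) (l : seq edge).

(** The half turn exchanging the ends of an edge. The fixed points are
    i sqrt n and n + i sqrt n on the vertical edges, and the highest points of
    the semicircles on the others. *)
Definition gen_mx (T : comNzRingType) e : 'M[T]_2 :=
  match e with
  | None => mx2 0 (- n%:R) 1 0
  | Some None => mx2 n%:R (- (n%:R ^+ 2 + n%:R)) 1 (- n%:R)
  | Some (Some j) => mx2 (2 * j%:R + 1) (- (2 * j%:R ^+ 2 + 2 * j%:R + 1))
                         2 (- (2 * j%:R + 1))
  end.

Definition gen e : PSL2 R := psl (gen_mx R e).

Definition word l : PSL2 R := foldr (fun e g => gen e * g)%g 1%g l.

Definition polygon_group : set (PSL2 R) := range word.

(** Each edge is a geodesic, the zero set of a linear form on the cone; the sign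
    is chosen so that the form is negative beyond the edge, as seen from the
    polygon. *)
Definition side e p : R :=
  match e with
  | None => p.1.2
  | Some None => n%:R * p.2 - p.1.2
  | Some (Some j) => p.1.1 - (2 * j%:R + 1) * p.1.2 + j%:R * (j%:R + 1) * p.2
  end.

Definition polygon : set R[i] :=
  [set z | 0 < complex.Im z /\ forall e, 0 <= side e (point_of_H z)].

Definition det_gen e : nat := if e is Some (Some _) then 1 else n.

Lemma det_gen_mx (T : comNzRingType) e : \det (gen_mx T e) = (det_gen e)%:R.
Proof. by case: e => [[j|]|] /=; rewrite det2; ring. Qed.

Lemma gen_mx_sqr (T : comNzRingType) e :
  gen_mx T e *m gen_mx T e = mx2 (- (det_gen e)%:R) 0 0 (- (det_gen e)%:R).
Proof. by case: e => [[j|]|] /=; rewrite mulmx2; congr mx2; ring. Qed.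

Lemma side_scale3 e k p : side e (scale3 k p) = k * side e p.
Proof. by case: e => [[j|]|] //=; ring. Qed.

Lemma disc_neg (j : 'I_n) p : cone p -> side (Some (Some j)) p < 0 ->
  [/\ 0 < p.2, j%:R * p.2 < p.1.2 & p.1.2 < (j%:R + 1) * p.2].
Proof.
case: p => -[s t] w [/= s0 w0 tsw] q0.
have j0 : 0 <= j%:R :> R by [].
have wp : 0 < w.
  rewrite lt_neqAle w0 andbT eq_sym; apply/eqP=> w_0.
  have t_0 : t = 0.
    by apply/eqP; rewrite -sqrf_eq0 eq_le sqr_ge0 andbT (le_trans tsw)// w_0 mulr0.
  by move: q0; rewrite w_0 t_0 !mulr0 subr0 addr0 ltNge s0.
have : (t - j%:R * w) * (t - (j%:R + 1) * w) < 0.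
  have := mulr_gt0 wp; rewrite -(pmulr_rlt0 _ wp) in q0; nra.
split=> //; nra.
Qed.

Lemma disc_pos (j : 'I_n) p : cone p -> 0 < p.2 ->
  p.1.2 < j%:R * p.2 \/ (j%:R + 1) * p.2 < p.1.2 -> 0 < side (Some (Some j)) p.
Proof.
case: p => -[s t] w [/= s0 w0 tsw] wp h.
rewrite -(pmulr_rgt0 _ wp).
have : 0 < (t - j%:R * w) * (t - (j%:R + 1) * w) by case: h => h; nra.
nra.
Qed.

(** A negative value of the form of an edge confines t / w to the open interval
    under that edge, and these intervals do not overlap. Strictness of the
    conclusion on the whole cone covers closed half planes and their ideal
    ends as well. *)
Lemma side_disjoint e f p : cone p -> e != f -> side e p < 0 -> 0 < side f p.
Proof.
move=> cp; have [s0 w0 tsw] := cp.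
have n0 : 0 <= n%:R :> R by [].
have jn (j : 'I_n) : j%:R + 1 <= n%:R :> R by rewrite natr1 ler_nat.
case: e f => [[j|]|] [[k|]|] //= ne q0.
- have [wp h1 h2] := disc_neg cp q0; apply: disc_pos => //.
  have [jk|kj|jk] := ltngtP j k; last by case/eqP: ne; do 2!congr Some; apply/val_inj.
    left; apply: lt_le_trans h2 _; rewrite ler_pM2r//.
    by rewrite natr1 ler_nat.
  right; apply: le_lt_trans h1; rewrite ler_pM2r//.
  by rewrite natr1 ler_nat.
- have [wp h1 h2] := disc_neg cp q0; rewrite subr_gt0.
  by apply: lt_le_trans h2 _; rewrite ler_pM2r.
- by have [wp h1 h2] := disc_neg cp q0; apply: le_lt_trans h1; rewrite mulr_ge0.
- have wp : 0 < p.2.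
    rewrite lt_neqAle w0 andbT eq_sym; apply/eqP=> w_0; move: tsw q0.
    by rewrite w_0 !mulr0; nra.
  apply: (@disc_pos k p cp wp); right.
  by rewrite subr_lt0 in q0; apply: le_lt_trans q0; rewrite ler_pM2r.
- by move: q0; rewrite subr_lt0; apply: le_lt_trans; rewrite mulr_ge0.
- have k0 : 0 <= k%:R :> R by []; have := mulr_ge0 (mulr_ge0 k0 k0) w0; nra.
- by have := mulr_ge0 n0 w0; lra.
Qed.

Hypothesis n_gt0 : (0 < n)%N.

Lemma det_gen_gt0 e : 0 < \det (gen_mx R e).
Proof. by rewrite det_gen_mx ltr0n; case: e => [[j|]|]. Qed.

Lemma side_gen e p : side e (gact (gen e) p) = - side e p.
Proof.
rewrite /gen gact_psl ?det_gen_gt0// side_scale3 det_gen_mx.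
have n0 : n%:R != 0 :> R by rewrite pnatr_eq0 -lt0n.
by case: e => [[j|]|] /=; rewrite /mxact !mx2E /=; field.
Qed.

Lemma gen_mul_gen e : (gen e * gen e)%g = 1%g.
Proof.
rewrite -pslM ?det_gen_gt0// gen_mx_sqr; apply: psl_scalar.
by rewrite oppr_eq0 pnatr_eq0 -lt0n; case: e => [[j|]|].
Qed.

Lemma mul_genK e g : (g * gen e * gen e)%g = g.
Proof. by rewrite -mulgA gen_mul_gen mulg1. Qed.

Lemma genV e : ((gen e)^-1)%g = gen e.
Proof. by apply: (mulgI (gen e)); rewrite mulgV gen_mul_gen. Qed.

Lemma word_cat l1 l2 : word (l1 ++ l2) = (word l1 * word l2)%g.
Proof. by elim: l1 => [|e l1 IH] /=; rewrite ?mul1g// IH mulgA. Qed.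

Lemma word_rev l : word (rev l) = ((word l)^-1)%g.
Proof.
elim: l => [|e l IH] /=; first by rewrite invg1.
by rewrite rev_cons -cats1 word_cat IH /= mulg1 invgM genV.
Qed.

Lemma gen_in e : polygon_group (gen e).
Proof. by exists [:: e] => //=; rewrite mulg1. Qed.

Lemma polygon_group_subgroup : is_subgroup polygon_group.
Proof.
split; first by exists [::].
  by move=> _ _ [l1 _ <-] [l2 _ <-]; exists (l1 ++ l2); rewrite ?word_cat.
by move=> _ [l _ <-]; exists (rev l); rewrite ?word_rev.
Qed.

Definition reduced l : bool := sorted (fun e f => e != f) l.

Lemma word_reduced l : exists2 l', reduced l' & word l = word l'.
Proof.
elim: l => [|e l [l' rl' IH]]; first by exists [::].
case: l' rl' IH => [|f l'] /= rl' IH; first by exists [:: e] => //=; rewrite IH.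
have [ef|ef] := eqVneq e f; last first.
  by exists (e :: f :: l') => /=; rewrite ?ef// IH.
by exists l'; [exact: path_sorted rl'|rewrite ef IH mulgA gen_mul_gen mul1g].
Qed.

(** Ping-pong: what lies beyond one edge lies on the near side of every other
    edge [e], and [gen e] exchanges the two sides of [e]. The weak inequalities
    admit the edges of the polygon and its ideal vertices. *)
Lemma pingpong e l p : cone p -> (forall f, 0 <= side f p) -> reduced (e :: l) ->
  side e (gact (word (e :: l)) p) <= 0.
Proof.
move=> cp p0; elim: l e => [|f l IH] e.
  by rewrite /= mulg1 side_gen oppr_le0.
rewrite [reduced _]/= => /andP[ef rl]; rewrite [word _]/= gactM side_gen oppr_le0.
rewrite leNgt; apply/negP=> /(side_disjoint (cone_gact _ cp) ef).
by rewrite ltNge IH.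
Qed.

Lemma pingpong_strict e l p : cone p -> (forall f, 0 < side f p) ->
  reduced (e :: l) -> side e (gact (word (e :: l)) p) < 0.
Proof.
move=> cp p0; elim: l e => [|f l IH] e.
  by rewrite /= mulg1 side_gen oppr_lt0.
rewrite [reduced _]/= => /andP[ef rl]; rewrite [word _]/= gactM side_gen oppr_lt0.
by apply: side_disjoint (IH _ rl); [exact: cone_gact|rewrite eq_sym].
Qed.

Lemma polygon_group_elim g : polygon_group g ->
  g = 1%g \/ exists e l, reduced (e :: l) /\ g = word (e :: l).
Proof.
case=> l _ <-; have [[|e l'] rl' ->] := word_reduced l; first by left.
by right; exists e, l'.
Qed.

End Polygon.

(** * Every rational is equivalent to infinity *)

Section Cusps.
Variables (R : realType) (n : nat).
Hypothesis n_gt0 : (0 < n)%N.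
Local Notation gen := (@gen R n).
Local Notation word := (@word R n).
Local Notation Gamma := (@polygon_group R n).
Local Notation left_edge := (None : edge n).
Local Notation right_edge := (Some None : edge n).
Local Notation disc j := (Some (Some j) : edge n).

Let n0 : n%:R != 0 :> R. Proof. by rewrite pnatr_eq0 -lt0n. Qed.
Let ngt0 : 0 < n%:R :> R. Proof. by rewrite ltr0n. Qed.

Lemma polygon_groupM g h : Gamma g -> Gamma h -> Gamma (g * h)%g.
Proof. by have [_ + _] := polygon_group_subgroup R n_gt0; apply. Qed.

Lemma polygon_groupV g : Gamma g -> Gamma (g^-1)%g.
Proof. by have [_ _] := polygon_group_subgroup R n_gt0; apply. Qed.

Lemma polygon_group1 : Gamma 1%g.
Proof. by have [] := polygon_group_subgroup R n_gt0. Qed.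

(** The map [x |-> - 2 j n - n / (x - j)] takes the vertex j to infinity; it
    is the product of the involutions of the first j + 1 edges. *)
Definition to_infinity_mx (j : nat) : 'M[R]_2 :=
  mx2 (- (2 * j%:R * n%:R)) (n%:R * (2 * j%:R ^+ 2 - 1)) 1 (- j%:R).

Definition to_infinity j : PSL2 R := psl (to_infinity_mx j).

Lemma det_to_infinity j : \det (to_infinity_mx j) = n%:R.
Proof. by rewrite det2; ring. Qed.

Lemma to_infinity0 : to_infinity 0 = gen left_edge.
Proof. by congr psl; congr mx2; ring. Qed.

Lemma to_infinityS (j : 'I_n) : to_infinity j.+1 = (to_infinity j * gen (disc j))%g.
Proof.
rewrite -pslM ?det_to_infinity ?det_gen_gt0//; congr psl.
by rewrite mulmx2 -natr1; congr mx2; ring.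
Qed.

Lemma to_infinity_in j : (j <= n)%N -> Gamma (to_infinity j).
Proof.
elim: j => [|j IH] jn; first by rewrite to_infinity0; exact: gen_in.
rewrite (to_infinityS (Ordinal jn)); apply: polygon_groupM; last exact: gen_in.
by apply: IH; exact: ltnW.
Qed.

Definition cusp_shift (k : int) : PSL2 R :=
  psl (mx2 1 (k%:~R * (n%:R * (2 * n%:R + 1))) 0 1).

Lemma cusp_shiftD k l : cusp_shift (k + l) = (cusp_shift k * cusp_shift l)%g.
Proof.
rewrite -pslM ?det2 ?mulr1 ?mulr0 ?subr0//; congr psl.
by rewrite mulmx2 intrD; congr mx2; ring.
Qed.

Lemma cusp_shift0 : cusp_shift 0 = 1%g.
Proof. by rewrite /cusp_shift mul0r psl_scalar. Qed.

Lemma cusp_shiftN k : cusp_shift (- k) = ((cusp_shift k)^-1)%g.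
Proof. by apply: (mulgI (cusp_shift k)); rewrite -cusp_shiftD subrr mulgV cusp_shift0. Qed.

(** Going once around the vertices yields a translation: this is the condition
    for the polygon to glue up to a complete surface with a single cusp. The
    sign is due to the order of the edges. *)
Lemma around_infinity : (to_infinity n * gen right_edge)%g = cusp_shift (-1).
Proof.
rewrite -pslM ?det_to_infinity ?det_gen_gt0//.
rewrite -[RHS](@pslZ _ (- n%:R)) ?oppr_eq0//; last by rewrite det2; lra.
by congr psl; rewrite mulmx2 scalemx2; congr mx2; ring.
Qed.

Lemma cusp_shift_natX (k : nat) : cusp_shift k = (cusp_shift 1 ^+ k)%g.
Proof.
elim: k => [|k IH]; first by rewrite cusp_shift0 expg0.
by rewrite intS cusp_shiftD IH expgS.
Qed.

Lemma cusp_shift_in k : Gamma (cusp_shift k).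
Proof.
have s1 : Gamma (cusp_shift 1).
  rewrite -[1]opprK cusp_shiftN; apply: polygon_groupV; rewrite -around_infinity.
  by apply: polygon_groupM; [exact: to_infinity_in|exact: gen_in].
have sn (m : nat) : Gamma (cusp_shift m).
  elim: m => [|m IH]; first by rewrite cusp_shift0; exact: polygon_group1.
  by rewrite intS cusp_shiftD; exact: polygon_groupM.
by case: (intP k) => [|m|m]; [exact: sn|exact: sn|rewrite cusp_shiftN; exact/polygon_groupV/sn].
Qed.

Definition cuspidal (x : option R) : Prop := exists2 g, Gamma g & bact g x = None.

Lemma cuspidal_bact g x : Gamma g -> cuspidal (bact g x) -> cuspidal x.
Proof. by move=> Gg [h Gh e]; exists (h * g)%g; [exact: polygon_groupM|rewrite bactM]. Qed.

Lemma cuspidal_shift (a q : R) k :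
  cuspidal (Some (n%:R * (a + k%:~R * (2 * n%:R + 1) * q) / q)) -> q != 0 ->
  cuspidal (Some (n%:R * a / q)).
Proof.
move=> + q0; set x := (X in cuspidal (Some X)) => cx.
apply: (@cuspidal_bact (cusp_shift k)); first exact: cusp_shift_in.
rewrite bact_psl ?det2; last by rewrite mulr0 subr0 mulr1.
rewrite /bmobius !mx2E mul0r add0r oner_eq0.
by rewrite (_ : _ / 1 = x)//; rewrite /x; field.
Qed.

(** Between the vertices j and j + 1, the map [to_infinity j] sends
    j + r / q, with 0 < r < q, to n times a fraction of denominator r. *)
Lemma cuspidal_nonneg_step (a q : nat) : (0 < q)%N -> (a < q)%N ->
  (forall (r : nat) (b : int), (0 < r < q)%N ->
     cuspidal (Some (n%:R * b%:~R / r%:R))) ->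
  cuspidal (Some (n%:R * a%:R / q%:R)).
Proof.
move=> q_gt0 aq IH; pose j := (n * a %/ q)%N; pose r := (n * a %% q)%N.
have jn : (j < n)%N by rewrite ltn_divLR// ltn_pmul2l.
have rq : (r < q)%N by rewrite ltn_mod.
have e : n%:R * a%:R = j%:R * q%:R + r%:R :> R.
  by rewrite -!natrM -natrD -divn_eq.
have q0 : q%:R != 0 :> R by rewrite pnatr_eq0 -lt0n.
apply: (@cuspidal_bact (to_infinity j)).
  exact/to_infinity_in/ltnW.
rewrite bact_psl ?det_to_infinity// /bmobius !mx2E mul1r.
have -> : n%:R * a%:R / q%:R - j%:R = r%:R / q%:R :> R by rewrite e; field.
have [r_0|r_gt0] := posnP r.
  by rewrite r_0 mul0r eqxx; exists 1%g; [exact: polygon_group1|exact: bact1].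
have r0 : r%:R != 0 :> R by rewrite pnatr_eq0 -lt0n.
rewrite mulf_eq0 invr_eq0 (negPf r0) (negPf q0) /=.
have := IH r (- (2 * j * r)%:Z - q%:Z); rewrite r_gt0 rq => /(_ isT).
congr (cuspidal (Some _)); rewrite e rmorphB rmorphN /= -!pmulrn !natrM.
by field; rewrite q0 r0.
Qed.

(** In the coordinate y = x / n this is the map y |-> m - 1 / (y - m), which
    belongs to PSL(2,Z) and lowers the denominator of every rational y at
    distance less than 1 from m. *)
Lemma odd_integer_map (i : nat) : let m := - (2 * i%:R + 1) : R in
  (to_infinity i.+1 * (to_infinity i)^-1)%g =
  psl (mx2 (n%:R * m) (- (n%:R ^+ 2 * (1 + m ^+ 2))) 1 (- (n%:R * m))).
Proof.
move=> m; set g := psl _.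
have dg : 0 < \det (mx2 (n%:R * m) (- (n%:R ^+ 2 * (1 + m ^+ 2))) 1 (- (n%:R * m))).
  by rewrite det2; have := mulr_gt0 ngt0 ngt0; lra.
suff -> : to_infinity i.+1 = (g * to_infinity i)%g by rewrite -mulgA mulgV mulg1.
rewrite -pslM ?det_to_infinity//.
rewrite -[LHS](@pslZ _ n%:R) ?det_to_infinity//; congr psl.
by rewrite mulmx2 scalemx2 -natr1; congr mx2; rewrite /m; ring.
Qed.

(** In the coordinate y = x / n, the even integers - 2 i are the images of oo
    under the maps [to_infinity i], and every other y of [- 2 n, 0] is at
    distance less than 1 from an odd integer. *)
Lemma cuspidal_neg_step (a q : nat) : (0 < q)%N -> (a <= 2 * n * q)%N ->
  (forall (r : nat) (b : int), (0 < r < q)%N ->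
     cuspidal (Some (n%:R * b%:~R / r%:R))) ->
  cuspidal (Some (n%:R * - a%:R / q%:R)).
Proof.
move=> q_gt0 aq IH; pose i := (a %/ (2 * q))%N; pose r := (a %% (2 * q))%N.
have q2 : (0 < 2 * q)%N by rewrite muln_gt0.
have ea : a = (i * (2 * q) + r)%N by exact: divn_eq.
have rq : (r < 2 * q)%N by rewrite ltn_mod.
have e : a%:R = i%:R * (2 * q%:R) + r%:R :> R by rewrite ea natrD !natrM.
have q0 : q%:R != 0 :> R by rewrite pnatr_eq0 -lt0n.
have [r_0|r_gt0] := posnP r.
  apply: (@cuspidal_bact (to_infinity i)^-1%g).
    apply/polygon_groupV/to_infinity_in; rewrite -(leq_pmul2r q2).
    by move: aq; rewrite ea r_0 addn0 (mulnC 2 n) -mulnA.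
  exists 1%g; first exact: polygon_group1.
  rewrite bact1; have <- : bact (to_infinity i) None = Some (n%:R * - a%:R / q%:R).
    rewrite bact_psl ?det_to_infinity// /bmobius !mx2E oner_eq0.
    by rewrite e r_0 divr1 /=; congr Some; field.
  by rewrite -bactM mulVg bact1.
have iln : (i < n)%N.
  rewrite ltnNge; apply/negP=> ni; move: aq; rewrite ea leqNgt => /negP; apply.
  rewrite -[X in (X < _)%N]addn0 -addnS leq_add// (mulnC 2) -mulnA.
  by rewrite leq_mul2r ni orbT.
pose m : R := - (2 * i%:R + 1).
apply: (@cuspidal_bact (to_infinity i.+1 * (to_infinity i)^-1)%g).
  by apply: polygon_groupM; [|apply: polygon_groupV]; apply: to_infinity_in => //; exact: ltnW.
rewrite odd_integer_map -/m.
rewrite bact_psl ?det2; last by have := mulr_gt0 ngt0 ngt0; lra.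
rewrite /bmobius !mx2E mul1r.
have -> : n%:R * - a%:R / q%:R - n%:R * m = n%:R * ((q%:R - r%:R) / q%:R).
  by rewrite e /m; field.
have [qr|qr] := eqVneq q r.
  by rewrite qr subrr mul0r mulr0 eqxx; exists 1%g; [exact: polygon_group1|exact: bact1].
have qr0 : q%:R - r%:R != 0 :> R by rewrite subr_eq0 eqr_nat.
rewrite !mulf_eq0 invr_eq0 (negPf n0) (negPf q0) (negPf qr0) /=.
have [rlq|qlr|/eqP] := ltngtP r q; last by rewrite eq_sym (negPf qr).
  have := IH (q - r)%N (- ((2 * i + 1) * (q - r))%:Z - q%:Z).
  rewrite subn_gt0 rlq ltn_subrL q_gt0 r_gt0 => /(_ isT).
  congr (cuspidal (Some _)); rewrite rmorphB rmorphN /= -!pmulrn.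
  rewrite !natrM natrD natrM natrB ?(ltnW rlq)// e /m.
  by field; rewrite q0 n0 qr0.
have := IH (r - q)%N (- ((2 * i + 1) * (r - q))%:Z + q%:Z).
rewrite subn_gt0 qlr ltn_subLR ?(ltnW qlr)// addnn -mul2n rq => /(_ isT).
congr (cuspidal (Some _)); rewrite rmorphD rmorphN /= -!pmulrn.
rewrite !natrM natrD natrM natrB ?(ltnW qlr)// e /m.
by field; rewrite q0 n0 qr0 -opprB oppr_eq0 qr0.
Qed.

(** A Euclidean algorithm: a translation brings y = a / q to [- 2 n, 1), and
    then one of the two preceding steps lowers q. *)
Lemma cuspidal_fraction (q : nat) (a : int) : (0 < q)%N ->
  cuspidal (Some (n%:R * a%:~R / q%:R)).
Proof.
elim/ltn_ind: q a => q IH a q_gt0.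
have {}IH (r : nat) (b : int) : (0 < r < q)%N -> cuspidal (Some (n%:R * b%:~R / r%:R)).
  by case/andP=> r0 rq; exact: IH.
have q0 : q%:R != 0 :> R by rewrite pnatr_eq0 -lt0n.
pose L : int := ((2 * n + 1) * q)%N; pose s : int := (2 * n * q)%N.
have L0 : 0 < L by rewrite ltz_nat muln_gt0 addn1.
pose k : int := - ((a + s) %/ L)%Z; pose b : int := ((a + s) %% L)%Z - s.
have b_lt : b < q.
  rewrite /b ltrBlDr (lt_le_trans (ltz_pmod _ L0))// /L mulnDl mul1n PoszD.
  by rewrite addrC.
have b_ge : - s <= b by rewrite /b lerDr modz_ge0// gt_eqF.
have eb : b = a + k * L by rewrite /b /k mulNr; have := divz_eq (a + s) L; lra.
apply: (@cuspidal_shift _ _ k) => //.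
have -> : a%:~R + k%:~R * (2 * n%:R + 1) * q%:R = b%:~R :> R.
  rewrite eb intrD intrM /L -pmulrn natrM natrD natrM; ring.
case: b b_lt b_ge {eb} => b; first by move=> bq _; exact: cuspidal_nonneg_step.
rewrite NegzE lerN2 => _ bs; rewrite rmorphN /= -pmulrn.
exact: cuspidal_neg_step.
Qed.

Lemma rational_orbit x : rational_cusps x -> exists2 g, Gamma g & bact g None = x.
Proof.
suff : rational_cusps x -> cuspidal x.
  move=> h /h[g Gg e]; exists g^-1%g; first exact: polygon_groupV.
  by rewrite -e -bactM mulVg bact1.
case=> [->|[r ->]]; first by exists 1%g; [exact: polygon_group1|exact: bact1].
have := @cuspidal_fraction (n * `|denq r|)%N (numq r).
rewrite muln_gt0 n_gt0 absz_gt0 denq_neq0 => /(_ isT).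
congr (cuspidal (Some _)); rewrite natrM /ratr.
have -> : `|denq r|%:R = (denq r)%:~R :> R by rewrite pmulrn absz_denq.
by field; rewrite intr_eq0 denq_neq0.
Qed.

End Cusps.

(** * The translates of the polygon cover the half plane *)

Section Covering.
Variables (R : realType) (n : nat).
Hypothesis n_gt0 : (0 < n)%N.
Implicit Types (p q : R * R * R) (l : seq (edge n)) (g : PSL2 R).
Local Notation gen := (@gen R n).
Local Notation word := (@word R n).
Local Notation Gamma := (@polygon_group R n).
Local Notation side := (@side R n).

(** The letters of [l] name the edges crossed on the way from the polygon to
    the point [p], each read in the frame of the translate that is being left. *)
Fixpoint deep l p : Prop :=
  if l is e :: l' then side e p < 0 /\ deep l' (gact (gen e) p) else True.

Lemma deep_scale3 l k p : 0 < k -> deep l p -> deep l (scale3 k p).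
Proof.
move=> k0; elim: l p => //= e l IH p [ep dp].
by rewrite side_scale3 gact_scale3 pmulr_rlt0//; split => //; exact: IH.
Qed.

Lemma side_gact_linear e g : exists a b c, forall p,
  side e (gact g p) = a * p.1.1 + b * p.1.2 + c * p.2.
Proof.
rewrite /gact; move: (val (repr g)) => A.
have h (f : R * R * R -> R) : (forall p, f p = f (1, 0, 0) * p.1.1 +
    f (0, 1, 0) * p.1.2 + f (0, 0, 1) * p.2) ->
    exists a b c, forall p, f p = a * p.1.1 + b * p.1.2 + c * p.2.
  by move=> fE; do 3!eexists.
apply: h => p; case: e => [[j|]|] /=; rewrite /mxact /=; ring.
Qed.

(** Every half plane that contains [p] but neither of the ideal points oo and
    0 also contains [q]. *)
Definition shadows p q : Prop := forall a b c : R, 0 <= a -> 0 <= c ->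
  a * p.1.1 + b * p.1.2 + c * p.2 < 0 -> a * q.1.1 + b * q.1.2 + c * q.2 < 0.

Lemma cone_infinity : cone (1, 0, 0 : R).
Proof. exact: (cone_point_of_boundary (None : option R)). Qed.

Lemma cone_zero : cone (0, 0, 1 : R).
Proof. by split=> //=; rewrite expr0n mul0r. Qed.

Lemma side_infinity e : 0 <= side e (1, 0, 0).
Proof. by case: e => [[j|]|] /=; rewrite ?mulr0 ?subr0 ?addr0. Qed.

Lemma side_zero e : 0 <= side e (0, 0, 1).
Proof.
case: e => [[j|]|] //=; rewrite ?mulr0 ?subr0 ?add0r mulr1 //.
Qed.

(** The half planes entered on the way to [p] never contain the vertices oo and
    0 of the polygon, because of ping-pong, so they also contain [q]. The
    hypothesis on [g] is the form in which this survives the induction. *)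
Lemma deep_shadows l g p q : cone p -> shadows p q ->
  (forall e, side e (gact g p) < 0 ->
    0 <= side e (gact g (1, 0, 0)) /\ 0 <= side e (gact g (0, 0, 1))) ->
  deep l (gact g p) -> deep l (gact g q).
Proof.
move=> cp pq; elim: l g => //= e l IH g inv [ep dp]; have [e1 e0] := inv e ep.
have [a [b [c lin]]] := side_gact_linear e g.
split.
  rewrite lin; apply: pq; last by rewrite -lin.
    by move: e1; rewrite lin /= mulr1 !mulr0 !addr0.
  by move: e0; rewrite lin /= mulr1 !mulr0 !add0r.
rewrite -gactM; apply: IH; rewrite gactM// => f fp.
have ef : f != e.
  by apply: contraTneq fp => ->; rewrite side_gen// -leNgt oppr_ge0 ltW.
split; rewrite leNgt gactM; apply/negP=> neg.
  have := side_disjoint (cone_gact _ (cone_gact _ cone_infinity)) ef neg.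
  by rewrite side_gen// oppr_gt0 ltNge e1.
have := side_disjoint (cone_gact _ (cone_gact _ cone_zero)) ef neg.
by rewrite side_gen// oppr_gt0 ltNge e0.
Qed.

(** The admissible x fill the whole interval between Re z and |z|^2 / Re z, and
    this leaves room for a rational one. *)
Lemma shadows_boundary (u v x : R) : 0 < v -> u != 0 -> 1 <= x / u ->
  x / u <= (u ^+ 2 + v ^+ 2) / u ^+ 2 ->
  shadows (point_of_H (u +i* v)%C) (point_of_boundary (Some x)).
Proof.
move=> v0 u0; set r := x / u => r1 r2 a b c a0 c0 /=.
have -> : x = r * u by rewrite /r divfK.
have u2 : 0 < u ^+ 2 by rewrite exprn_even_gt0.
have {r2} r2 : r * u ^+ 2 <= u ^+ 2 + v ^+ 2 by rewrite -ler_pdivlMr.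
rewrite !mulr1 => h.
have r0 : 0 < r by exact: lt_le_trans r1.
rewrite -(pmulr_rlt0 _ r0) in h.
apply: le_lt_trans h; rewrite !mulrDr.
have h1 : c <= r * c by rewrite ler_peMl.
have h2 : a * (r * u) ^+ 2 <= r * (a * (u ^+ 2 + v ^+ 2)).
  have -> : a * (r * u) ^+ 2 = r * a * (r * u ^+ 2) by ring.
  by rewrite (mulrA r a) ler_wpM2l// mulr_ge0// ltW.
have -> : r * (b * u) = b * (r * u) by rewrite mulrCA.
lra.
Qed.

Lemma deep_uncovered (z : R[i]) : 0 < complex.Im z ->
  (forall g, Gamma g -> ~ polygon n (act g z)) ->
  forall m, exists2 l, size l = m & deep l (point_of_H z).
Proof.
move=> z0 zn m; elim: m z z0 zn => [|m IH] z z0 zn; first by exists [::].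
have [e ez] : exists e, side e (point_of_H z) < 0.
  apply: contrapT => /forallNP h; apply: (zn 1%g); first exact: polygon_group1.
  by rewrite act1//; split => // e; rewrite leNgt; apply/negP/h.
have [ez0 [k k0 ek]] := gact_point_of_H (gen e) z0.
have [|l ll dl] := IH (act (gen e) z) ez0.
  move=> g Gg; rewrite -actM//; apply: zn; apply: polygon_groupM => //; exact: gen_in.
exists (e :: l); rewrite /= ?ll//; split => //.
by rewrite ek; exact: deep_scale3.
Qed.

(** The path to the image of oo under a reduced word spells a prefix of that
    word, since the half planes beyond distinct edges are disjoint. *)
Lemma deep_cusp (lx l : seq (edge n)) : reduced lx ->
  deep l (gact (word lx) (1, 0, 0)) -> (size l <= size lx)%N.
Proof.
elim: lx l => [|f lx IH] [|e l] //.
  by move=> _ /= [+ _]; rewrite gact1 ltNge side_infinity.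
move=> rl [neg dl]; have ef : e = f.
  apply/eqP; apply/negPn/negP=> ef.
  have := pingpong n_gt0 cone_infinity side_infinity rl.
  by rewrite leNgt (side_disjoint _ ef)//; exact/cone_gact/cone_infinity.
apply: IH; first exact: path_sorted rl.
by move: dl; rewrite ef /= -gactM mulgA gen_mul_gen// mul1g.
Qed.

(** A point outside all translates would have infinitely long paths; a rational
    in its shadow would have them too, although it is an image of oo. *)
Lemma polygon_covers (z : R[i]) : 0 < complex.Im z ->
  exists2 g, Gamma g & polygon n (act g z).
Proof.
move=> z0; apply: contrapT => nz.
have {}nz g : Gamma g -> ~ polygon n (act g z) by move=> Gg Pg; apply: nz; exists g.
case: z => u v /= in z0 nz *.
have [u0|u0] := eqVneq u 0.
  (* The imaginary axis is itself an edge of the polygon. *)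
  apply: (nz 1%g); first exact: polygon_group1.
  rewrite act1//; split => // -[[j|]|] /=; rewrite u0 ?subr0 ?mulr1//.
  by rewrite mulr0 subr0 expr0n add0r addr_ge0 ?sqr_ge0// mulr_ge0// addr_ge0.
have : 1 < (u ^+ 2 + v ^+ 2) / u ^+ 2.
  by rewrite ltr_pdivlMr ?exprn_even_gt0// mul1r ltrDl exprn_even_gt0//= gt_eqF.
set m := (_ / _) => m1.
have [r] : exists r : rat, 1 <= ratr r / u <= m.
  have [up|un|/eqP] := ltgtP 0 u; last by rewrite eq_sym (negPf u0).
    have /rat_in_itvoo[r] : u < m * u by rewrite ltr_pMl.
    rewrite in_itv /= => /andP[h1 h2]; exists r.
    by apply/andP; split; [rewrite ler_pdivlMr// mul1r|rewrite ler_pdivrMr//]; exact: ltW.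
  have /rat_in_itvoo[r] : m * u < u by rewrite gtr_nMl.
  rewrite in_itv /= => /andP[h1 h2]; exists r.
  by apply/andP; split; [rewrite ler_ndivlMr// mul1r|rewrite ler_ndivrMr//]; exact: ltW.
move=> /andP[r1 r2].
have [|_ [lx0 _ <-] ex] := @rational_orbit R n n_gt0 (Some (ratr r)).
  by right; exists r.
have [lx rlx elx] := word_reduced R n_gt0 lx0; rewrite elx in ex.
have [l ll dl] := @deep_uncovered (u +i* v)%C z0 nz (size lx).+1.
have := @deep_shadows l 1%g _ _ (cone_point_of_H _) (shadows_boundary z0 u0 r1 r2).
rewrite !gact1 => /(_ (fun e _ => conj (side_infinity e) (side_zero e)) dl) dx.
have [k k0 ek] := gact_point_of_boundary (word lx) None.
have : deep l (gact (word lx) (1, 0, 0)).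
  by rewrite -[(1, 0, 0)]/(point_of_boundary None) ek ex; exact: deep_scale3.
by move=> /(deep_cusp rlx); rewrite ll ltnn.
Qed.

End Covering.

(** * The cusp set *)

Lemma conj_power (gT : groupType) (x y : gT) k :
  ((x * y * x^-1) ^+ k)%g = (x * y ^+ k * x^-1)%g.
Proof.
elim: k => [|k IH]; first by rewrite !expg0 mulg1 mulgV.
by rewrite !expgS IH !mulgA -(mulgA _ x^-1%g x) mulVg mulg1.
Qed.

Section CuspSet.
Variables (R : realType) (n : nat).
Hypothesis n_gt0 : (0 < n)%N.
Implicit Types (p q : R * R * R) (l : seq (edge n)) (g : PSL2 R).
Local Notation gen := (@gen R n).
Local Notation word := (@word R n).
Local Notation Gamma := (@polygon_group R n).
Local Notation side := (@side R n).
Local Notation cusp_shift := (@cusp_shift R n).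
Local Notation to_infinity := (@to_infinity R n).

Local Arguments bact : simpl never.

Definition ideal_vertex (v : option 'I_n.+1) : option R :=
  if v is Some j then Some j%:R else None.

Definition vertex_map (v : option 'I_n.+1) : PSL2 R :=
  if v is Some j then to_infinity j else 1%g.

Lemma ideal_vertex_inj : injective ideal_vertex.
Proof.
move=> [i|] [j|] //= [] /eqP; rewrite eqr_nat => /eqP ij.
by congr Some; apply/val_inj.
Qed.

Lemma side_ideal_vertex e v : 0 <= side e (point_of_boundary (ideal_vertex v)).
Proof.
case: v => [j|] /=; last exact: side_infinity.
case: e => [[i|]|] //=; last by rewrite mulr1 subr_ge0 ler_nat -ltnS.
have -> : j%:R ^+ 2 - (2 * i%:R + 1) * j%:R + i%:R * (i%:R + 1) * 1 =
  (j%:R - i%:R) * (j%:R - (i%:R + 1)) :> R by ring.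
rewrite natr1; have [ji|ij] := leqP j i.
  by rewrite mulr_le0 ?subr_le0 ?ler_nat// leqW.
by rewrite mulr_ge0 ?subr_ge0 ?ler_nat// ltnW.
Qed.

(** Only two edges meet at a vertex, and crossing either of them amounts, after
    the vertex is sent to oo, to moving to the next strip; a full turn around
    the polygon contributes the translation. This is what makes stabilizers
    cyclic. *)
Lemma edge_flip e v : side e (point_of_boundary (ideal_vertex v)) <= 0 ->
  exists v' k, bact (gen e) (ideal_vertex v) = ideal_vertex v' /\
    (vertex_map v * gen e)%g = (cusp_shift k * vertex_map v')%g.
Proof.
have n0 : n%:R != 0 :> R by rewrite pnatr_eq0 -lt0n.
case: e => [[i|]|]; case: v => [j|]; rewrite /= ?mulr0 ?subr0 ?addr0 ?mulr1.
- have -> : j%:R ^+ 2 - (2 * i%:R + 1) * j%:R + i%:R * (i%:R + 1) =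
    (j%:R - i%:R) * (j%:R - (i%:R + 1)) :> R by ring.
  rewrite natr1 => h.
  have [ji|ji] : j = i :> nat \/ j = i.+1 :> nat.
    have [ji|ij|] := ltngtP j i; last by left.
      move: h; rewrite leNgt nmulr_rgt0 ?subr_lt0 ?ltr_nat// ?ltnS ?(ltnW ji)//.
    right; apply/eqP; rewrite eqn_leq ij andbT leqNgt; apply/negP=> ij2.
    by move: h; rewrite leNgt pmulr_rgt0 ?subr_gt0 ?ltr_nat// ij2.
  + exists (Some (Ordinal (ltn_ord i : (i.+1 < n.+1)%N))), 0.
    rewrite cusp_shift0 mul1g; split; last by rewrite /vertex_map /= ji to_infinityS.
    rewrite bact_psl ?det_gen_gt0//= !mx2E ji.
    have -> : 2 * i%:R - (2 * i%:R + 1) = -1 :> R by ring.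
    by rewrite oppr_eq0 oner_eq0 -(natr1 i); congr Some; field.
  + exists (Some (widen_ord (leqnSn n) i)), 0; rewrite cusp_shift0 mul1g; split; last first.
      by rewrite /vertex_map /= ji to_infinityS// mul_genK.
    rewrite bact_psl ?det_gen_gt0//= !mx2E ji -(natr1 i).
    have -> : 2 * (i%:R + 1) - (2 * i%:R + 1) = 1 :> R by ring.
    by rewrite oner_eq0; congr Some; field.
- by rewrite ler10.
- rewrite subr_le0 ler_nat => nj.
  have -> : j = ord_max by apply/val_inj/eqP; rewrite eqn_leq nj -ltnS ltn_ord.
  exists None, (-1); split; last by rewrite /vertex_map mulg1 around_infinity.
  by rewrite bact_psl ?det_gen_gt0//= !mx2E mul1r subrr eqxx.
- move=> _; exists (Some ord_max), 1; split.
    by rewrite bact_psl ?det_gen_gt0//= !mx2E oner_eq0 divr1.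
  rewrite /vertex_map mul1g -[LHS]mul1g -(cusp_shift0 R n) -(subrr 1) cusp_shiftD.
  by rewrite -around_infinity// -[LHS]mulgA mul_genK.
- rewrite (ler_nat _ j 0) leqn0 => /eqP j0.
  exists None, 0; rewrite cusp_shift0 mul1g; split.
    by rewrite bact_psl ?det_gen_gt0//= !mx2E mul1r j0 addr0 eqxx.
  by rewrite /vertex_map j0 to_infinity0 gen_mul_gen.
- move=> _; exists (Some ord0), 0; rewrite cusp_shift0 !mul1g; split.
    by rewrite bact_psl ?det_gen_gt0//= !mx2E oner_eq0 mul0r.
  by rewrite /vertex_map to_infinity0.
Qed.

(** Ping-pong forces the first letter of the word to be one of the two edges at
    the vertex [v'], and [edge_flip] removes it. *)
Lemma vertex_transporter l v v' : reduced l ->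
  bact (word l) (ideal_vertex v) = ideal_vertex v' ->
  exists k, (vertex_map v' * word l)%g = (cusp_shift k * vertex_map v)%g.
Proof.
elim: l v' => [|e l IH] v' rl.
  by rewrite bact1 => /ideal_vertex_inj <-; exists 0; rewrite cusp_shift0 mulg1 mul1g.
move=> ev.
have : side e (point_of_boundary (ideal_vertex v')) <= 0.
  have := pingpong n_gt0 (cone_point_of_boundary _) (side_ideal_vertex ^~ v) rl.
  have [k k0 ->] := gact_point_of_boundary (word (e :: l)) (ideal_vertex v).
  by rewrite ev side_scale3 pmulr_rle0.
move=> /edge_flip[v'' [k [ev'' ek]]].
have [|k' ek'] := IH v'' (path_sorted rl).
  by rewrite -ev'' -ev /= -bactM mulgA gen_mul_gen// mul1g.
by exists (k + k'); rewrite /= mulgA ek -mulgA ek' cusp_shiftD mulgA.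
Qed.

Lemma stabilizer_infinity g : Gamma g -> bact g None = None ->
  exists k, g = cusp_shift k.
Proof.
move=> [l0 _ <-]; have [l rl ->] := word_reduced R n_gt0 l0.
move=> /(@vertex_transporter l None None rl)[k]; rewrite mul1g mulg1 => ->.
by exists k.
Qed.

Definition trace_sqr g : R := \tr (val (repr g)) ^+ 2.

Lemma trace_sqr_psl (A : 'M[R]_2) : 0 < \det A ->
  trace_sqr (psl A) = \tr A ^+ 2 / \det A.
Proof.
move=> dA; rewrite /trace_sqr; have [k k2 ->] := repr_psl dA.
by rewrite mxtraceZ exprMn k2 mulrC.
Qed.

Lemma trace_sqr_conj g h : trace_sqr (g * h * g^-1)%g = trace_sqr h.
Proof.
rewrite -{1}[g]psl_repr -{1}[h]psl_repr -{2}[g]psl_repr.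
set A := val (repr g); set B := val (repr h).
have [uA dA dB] : [/\ A \in unitmx, \det A = 1 & \det B = 1].
  by rewrite /A /B SL2_unit !det_repr.
have dV : \det (invmx A) = 1 by rewrite det_inv dA invr1.
have -> : ((psl A)^-1)%g = psl (invmx A).
  by apply: (mulgI (psl A)); rewrite mulgV -pslM ?dA ?dV// mulmxV// psl1.
rewrite -!pslM ?det_mulmx ?dA ?dB ?dV ?mulr1//.
rewrite trace_sqr_psl ?det_mulmx ?dA ?dB ?dV ?mulr1//.
by rewrite invr1 mulr1 mxtrace_mulC mulmxA mulVmx// mul1mx.
Qed.

Lemma parabolic_shift_conj g : parabolic (g * cusp_shift 1 * g^-1)%g.
Proof.
split; last first.
  rewrite -/(trace_sqr _) trace_sqr_conj trace_sqr_psl ?det2 ?mulr1 ?mulr0 ?subr0//.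
  by rewrite tr2E !mx2E divr1; ring.
move=> /(congr1 (fun h => g^-1 * h * g)%g).
rewrite !mulgA mulVg mul1g -mulgA mulVg !mulg1.
rewrite mulVg => /(congr1 (fun h => bact h (Some 0))); rewrite bact1.
rewrite bact_psl ?det2 ?mulr1 ?mulr0 ?subr0//= !mx2E mulr0 !add0r oner_eq0 mul1r divr1.
move=> -[] /eqP; rewrite add0r mul1r mulf_eq0 pnatr_eq0 eqn0Ngt n_gt0 /=.
by rewrite -natrM natr1 pnatr_eq0.
Qed.

(** The stabilizer of a rational is conjugate to that of oo. *)
Lemma rational_cusp x : rational_cusps x -> cusp_set Gamma x.
Proof.
move=> /(@rational_orbit R n n_gt0)[g Gg ex].
exists (g * cusp_shift 1 * g^-1)%g; first exact: parabolic_shift_conj.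
have GS k : Gamma (g * cusp_shift k * g^-1)%g.
  apply: polygon_groupM => //; last exact: polygon_groupV.
  by apply: polygon_groupM => //; exact: cusp_shift_in.
have Sx k : bact (g * cusp_shift k * g^-1)%g x = x.
  rewrite -ex -bactM -mulgA mulVg mulg1 bactM; congr bact.
  by rewrite bact_psl ?det2 ?mulr1 ?mulr0 ?subr0//= !mx2E eqxx.
apply/seteqP; split => [h [Gh hx]|h [k]].
  have [||k ek] := @stabilizer_infinity (g^-1 * h * g)%g.
  - by apply: polygon_groupM => //; apply: polygon_groupM => //; exact: polygon_groupV.
  - by rewrite !bactM ex hx -ex -bactM mulVg bact1.
  have -> : h = (g * cusp_shift k * g^-1)%g.
    by rewrite -ek !mulgA mulgV mul1g -mulgA mulgV mulg1.
  case: (intP k) => [|m|m].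
  - by exists 0%N; left; rewrite cusp_shift_natX conj_power.
  - by exists m.+1; left; rewrite conj_power cusp_shift_natX.
  - by exists m.+1; right; rewrite conj_power cusp_shiftN cusp_shift_natX !invgM invgK mulgA.
rewrite conj_power -cusp_shift_natX => -[|] ->; first by split; [exact: GS|exact: Sx].
by rewrite !invgM invgK mulgA -cusp_shiftN; split; [exact: GS|exact: Sx].
Qed.

(** * Rationality of the group and of its cusps *)

Lemma polygon_group_integral g : Gamma g -> exists (B : 'M[int]_2) k,
  \det B = (n ^ k)%N /\ g = psl (map_mx intr B).
Proof.
case=> l _ <-{g}; elim: l => [|e l [B [k [dB eB]]]].
  by exists 1%:M, 0%N; rewrite det1 map_mx1 psl1.
have genE : map_mx intr (gen_mx int e) = gen_mx R e.
  apply/matrixP => i j; rewrite mxE; case: e => [[a|]|] /=; rewrite !mxE;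
    do 2 case: ifP => _; rewrite ?rmorphN ?rmorphD ?rmorphM ?rmorphXn //=;
    by rewrite ?rmorph_nat.
have dBR : 0 < \det (map_mx intr B : 'M[R]_2).
  by rewrite det_map_mx dB /= -pmulrn ltr0n expn_gt0 n_gt0.
have [d ed] : exists d, det_gen e = (n ^ d)%N.
  by case: e {genE} => [[a|]|]; [exists 0%N|exists 1%N|exists 1%N]; rewrite ?expn1.
exists (gen_mx int e *m B), (d + k)%N; split.
  by rewrite det_mulmx dB det_gen_mx ed expnD PoszM natz.
by rewrite map_mxM genE pslM ?det_gen_gt0// -eB.
Qed.

Lemma polygon_group_PGL2Q : Gamma `<=` @PGL2Q R.
Proof.
move=> g /polygon_group_integral[B [k [dB eB]]].
pose Bq : 'M[rat]_2 := map_mx intr B.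
have dBq : \det Bq = (n ^ k)%:R by rewrite det_map_mx dB /= -pmulrn.
have eBR : map_mx ratr Bq = map_mx intr B :> 'M[R]_2.
  by apply/matrixP => i j; rewrite !mxE ratr_int.
have eq_det : ratr (\det Bq) = \det (map_mx intr B : 'M[R]_2).
  by rewrite -eBR [RHS]det_map_mx.
have nk : (0 < n ^ k)%N by rewrite expn_gt0 n_gt0.
have dB0 : 0 < \det (map_mx intr B : 'M[R]_2).
  by rewrite det_map_mx dB /= -pmulrn ltr0n.
exists Bq, (insubd (1%g : SL2 R) ((Num.sqrt (\det (map_mx intr B : 'M[R]_2)))^-1
  *: map_mx intr B)); split => //.
  by rewrite dBq ltr0n.
by rewrite val_psl// eq_det eBR.
Qed.

(** The fixed point of a parabolic integral matrix is the double root of an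
    integral quadratic polynomial, hence rational. *)
Lemma integral_parabolic_fixed (B : 'M[int]_2) (x : option R) :
  let A : 'M[R]_2 := map_mx intr B in
  0 < \det A -> parabolic (psl A) -> bact (psl A) x = x -> rational_cusps x.
Proof.
move=> A dA [A1 trA]; rewrite bact_psl//; case: x => [t|]; last by left.
have h2 : (A 0 0 + A 1 1) ^+ 2 = 4 * (A 0 0 * A 1 1 - A 0 1 * A 1 0).
  by rewrite -tr2E -det2E -trA -/(trace_sqr _) trace_sqr_psl// divfK ?lt0r_neq0.
rewrite /bmobius; case: ifPn => // ctd [] e.
have h1 : t * (A 1 0 * t + A 1 1) = A 0 0 * t + A 0 1 by rewrite -{1}e divfK.
have h3 : (2 * A 1 0 * t + A 1 1 - A 0 0) ^+ 2 = 0.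
  transitivity (4 * A 1 0 * (t * (A 1 0 * t + A 1 1) - (A 0 0 * t + A 0 1)) +
    ((A 0 0 + A 1 1) ^+ 2 - 4 * (A 0 0 * A 1 1 - A 0 1 * A 1 0))); first by ring.
  by rewrite h1 h2 !subrr mulr0 addr0.
move/eqP: h3; rewrite sqrf_eq0 => /eqP h3.
have [c0|c0] := eqVneq (A 1 0) 0; last first.
  right; exists ((B 0 0 - B 1 1)%:~R / (2 * B 1 0)%:~R).
  rewrite fmorph_div !rmorph_int intrB intrM; congr Some.
  move: h3 c0; rewrite !mxE => h3 c0.
  apply: (@mulIf _ (2 * (B 1 0)%:~R)); first by rewrite mulf_neq0.
  by rewrite divfK ?mulf_neq0//; lra.
case: A1; move: h1 h3; rewrite c0 !mulr0 !mul0r !add0r => h1 h3.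
have e1 : A 1 1 = A 0 0 by lra.
have e2 : A 0 1 = 0 by move: h1; rewrite e1; lra.
rewrite [A]mx2_eta c0 e1 e2; apply: psl_scalar; apply/eqP=> a0.
by move: dA; rewrite det2E c0 a0 mul0r mulr0 subrr ltxx.
Qed.

Lemma polygon_group_cusps : cusp_set Gamma = @rational_cusps R.
Proof.
apply/seteqP; split => [x [p pp Sx]|x]; last exact: rational_cusp.
have [Gp px] : cusp_stabilizer Gamma x p by rewrite Sx; exists 1%N; left; rewrite expg1.
have [B [k [dB eB]]] := polygon_group_integral Gp.
rewrite eB in pp px; apply: integral_parabolic_fixed pp px.
by rewrite det_map_mx dB /= -pmulrn ltr0n expn_gt0 n_gt0.
Qed.

End CuspSet.

(** * Discreteness *)

Section Discreteness.
Variables (R : realType) (n : nat).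
Hypothesis n_gt0 : (0 < n)%N.
Implicit Types (p q : R * R * R) (g : PSL2 R).
Local Notation Gamma := (@polygon_group R n).
Local Notation side := (@side R n).

Definition interior_point : R[i] := (n%:R / 2 +i* 1)%C.

Lemma side_interior_point e : 0 < side e (point_of_H interior_point).
Proof.
have ngt0 : 0 < n%:R :> R by rewrite ltr0n.
case: e => [[j|]|] /=; [|lra|lra].
have := sqr_ge0 (n%:R / 2 - j%:R - 1 / 2 : R); nra.
Qed.

(** By strict ping-pong a nontrivial element moves the polygon off its interior
    points. *)
Lemma polygon_group_eq1 g : Gamma g ->
  (forall e, 0 < side e (gact g (point_of_H interior_point))) -> g = 1%g.
Proof.
case/(polygon_group_elim n_gt0) => // -[e [l [rl ->]]] /(_ e).
by rewrite ltNge ltW// pingpong_strict//; [exact: cone_point_of_H|exact: side_interior_point].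
Qed.

Lemma side_gact_continuous e g p : continuous (fun h : PSL2 R => side e (gact g (gact h p))).
Proof.
have [a [b [c lin]]] := side_gact_linear e g.
pose F (M : 'M[R]_2) : R := side e (gact g (mxact M p)).
have cvgF (Fl : set_system 'M[R]_2) (M : 'M[R]_2) : Filter Fl ->
    (forall i j, (fun N : 'M[R]_2 => N i j) @ Fl --> M i j) -> F @ Fl --> F M.
  move=> FF cE; rewrite /F lin; under eq_fun do rewrite lin.
  rewrite /mxact /= !expr2.
  by do ![exact: cE|exact: cvg_cst|apply: cvgM|apply: cvgD].
have cF : continuous F.
  move=> M; have FM : Filter (nbhs M) by exact: nbhs_filter.
  exact: (cvgF (nbhs M) M FM (fun i j => @coord_continuous R 2 2 i j M)).
apply: (@repr_comp_continuous _ _ _ (fun A : SL2 R => F (val A))) => [A|A B].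
  apply: (@continuous_comp _ _ _ (fun A : SL2 R => val A : 'M[R]_2) F A); last exact: cF.
  exact: (@initial_continuous _ _ (@SL2val R)).
move=> /toPSL2_eqP[] eAB; apply/eqP; rewrite /F eAB//.
by rewrite -scaleN1r mxactZ sqrrN expr1n scale31.
Qed.

(** The elements that move a fixed interior point into the interior of [g] times
    the polygon form a neighbourhood of [g]. *)
Lemma polygon_group_discrete : discrete Gamma.
Proof.
move=> g Gg; split; first exact/mem_set.
pose p0 := point_of_H interior_point.
exists [set h | forall e, 0 < side e (gact g^-1%g (gact h p0))].
  have FG : Filter (nbhs g) by exact: nbhs_filter.
  apply: (@filter_forall _ _ (fun e h => 0 < side e (gact g^-1%g (gact h p0))) _ FG) => e.
  apply: (cvgr_gt _ (@side_gact_continuous e g^-1%g p0 g)).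
  by rewrite -gactM mulVg gact1; exact: side_interior_point.
apply/seteqP; split => [h [hp Gh]|_ ->] /=.
  have /(@polygon_group_eq1 (g^-1 * h)%g) : Gamma (g^-1 * h)%g.
    by apply: polygon_groupM => //; exact: polygon_groupV.
  move=> -/(_ _) e1; apply: (mulgI g^-1%g); rewrite mulVg; apply: e1 => e.
  by rewrite gactM; exact: hp.
by split => // e; rewrite -gactM mulVg gact1; exact: side_interior_point.
Qed.

End Discreteness.

(** * Area of the polygon *)

Section Area.
Variable R : realType.
Local Notation leb := (@lebesgue_measure R).
Implicit Types (F : set R[i]).

Lemma measurable_form_ge0 (a b c d : R) : measurable
  [set p : R * R | 0 <= a * (p.1 ^+ 2 + p.2 ^+ 2) + b * p.1 + c * p.2 + d].
Proof.
rewrite -[X in measurable X]setTI; apply: measurable_fun_le => //.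
apply: measurable_funD => //; apply: measurable_funD => //.
  apply: measurable_funD => //; apply: measurable_funM => //.
  by apply: measurable_funD => //; exact: measurable_funX.
by apply: measurable_funM.
Qed.

Lemma measurable_upper_half : measurable [set p : R * R | 0 < p.2].
Proof.
have := measurableC (measurable_form_ge0 0 0 (-1) 0); congr measurable.
apply/seteqP; split => p /=; rewrite !mul0r !add0r addr0 mulN1r oppr_ge0.
  by move/negP; rewrite -ltNge.
by rewrite ltNge => /negP.
Qed.

(** Slicing horizontally avoids the singularities that a vertical slicing
    produces at the ideal vertices. *)
Lemma hyp_area_slices F : F `<=` @upper_half_plane R -> measurable (plane_set F) ->
  hyp_area F = (\int[leb]_y ((y ^- 2)%:E * leb (ysection (plane_set F) y)))%E.
Proof.
move=> FH mF; rewrite /hyp_area integral_mkcond fubini_tonelli2.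
- apply: eq_integral => y _; rewrite /fubini_G.
  rewrite -integral_cst; last exact: measurable_ysection.
  rewrite [RHS]integral_mkcond; apply: eq_integral => x _.
  by rewrite !patchE mem_ysection.
- apply: (iffLR (measurable_restrictT _ mF)); apply/measurable_EFinP.
  apply: (@eq_measurable_fun _ _ _ _ _ (fun p : R * R => p.2 `^ (- 2))).
    move=> p; rewrite inE => /FH /= p0.
    by rewrite powRN (@powR_mulrn _ _ 2) ?ltW.
  apply: measurable_funTS.
  by apply: (@measurableT_comp _ _ _ _ _ _ (fun y : R => y `^ (- 2)) _ snd).
- by move=> p; rewrite patchE; case: ifP => // _; rewrite lee_fin invr_ge0 sqr_ge0.
Qed.

(** Each horizontal line meets a circle or a vertical line in at most two
    points. *)
Lemma null_circle F (a b c : R) :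
  F `<=` @upper_half_plane R -> measurable (plane_set F) ->
  (a != 0) || (b != 0) ->
  (forall z, F z ->
    a * (complex.Re z ^+ 2 + complex.Im z ^+ 2) + b * complex.Re z + c = 0) ->
  hyp_area F = 0%E.
Proof.
move=> FH mF ab Fz; rewrite hyp_area_slices//.
rewrite (eq_integral (cst 0%E)) ?integral0// => y _ /=.
rewrite countable_lebesgue_measure0 ?mule0//.
have [->|/set0P[r]] := eqVneq (ysection (plane_set F) y) set0; first exact: countable0.
rewrite /ysection /= inE => /Fz /= er.
apply: (@sub_countable _ _ _ [set r; (if a == 0 then r else - b / a - r)]); last first.
  exact/finite_set_countable/finite_set2.
apply: subset_card_le => x /=; rewrite inE => /Fz /= ex.
have {er ex} : (x - r) * (a * (x + r) + b) = 0.
  by transitivity (a * (x ^+ 2 + y ^+ 2) + b * x + c -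
    (a * (r ^+ 2 + y ^+ 2) + b * r + c)); [ring|rewrite er ex subrr].
move/eqP; rewrite mulf_eq0 subr_eq0 => /orP[/eqP ->|]; first by left.
have [a0|a0] := eqVneq a 0.
  by move: ab; rewrite a0 eqxx /= mul0r add0r => /negPf ->.
move=> /eqP e; right; apply: (mulfI a0).
by rewrite mulrBr mulrCA divff// mulr1; lra.
Qed.

(** The integrand of the sliced area is at most 5 m / (1 + y ^ 2), which is
    integrable; the factor 5 is the value of (1 + y ^ 2) / y ^ 2 at the height
    y = 1 / 2 where the two bounds agree. *)
Lemma finite_slices F (m : R) :
  F `<=` @upper_half_plane R -> measurable (plane_set F) ->
  0 <= m ->
  (forall y, 0 < y -> (leb (ysection (plane_set F) y) <= m%:E)%E) ->
  (forall y, 0 < y -> (leb (ysection (plane_set F) y) <= (m * (4 * y ^+ 2))%:E)%E) ->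
  (hyp_area F < +oo)%E.
Proof.
move=> FH mF m0 h1 h2; rewrite hyp_area_slices//.
pose G (y : R) : \bar R := ((y ^- 2)%:E * leb (ysection (plane_set F) y))%E.
have G0 y : (0 <= G y)%E by rewrite mule_ge0// lee_fin invr_ge0 sqr_ge0.
have Gneg y : y < 0 -> G y = 0%E.
  move=> y0; rewrite /G (_ : ysection _ _ = set0) ?measure0 ?mule0//.
  apply/seteqP; split => // x; rewrite /ysection /= inE => /FH y1.
  by have := lt_trans y0 y1; rewrite ltxx.
pose D0 : set R := [set` `[0, +oo[].
have mD0 : measurable D0 by exact: measurable_itv.
have mG : measurable_fun D0 G.
  apply: emeasurable_funM; last by apply: measurable_funTS; exact: measurable_fun_ysection.
  apply/measurable_EFinP; apply: (@eq_measurable_fun _ _ _ _ _ (fun y : R => y `^ (- 2))).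
    by move=> y; rewrite inE /D0 /= in_itv /= andbT => y0; rewrite powRN (@powR_mulrn _ _ 2).
  exact: measurable_funTS.
have GE : (\int[leb]_y G y = \int[leb]_(y in D0) G y)%E.
  rewrite [RHS]integral_mkcond; apply: eq_integral => y _; rewrite patchE.
  by rewrite /D0 mem_setE in_itv /= andbT; case: leP => // /Gneg.
rewrite [X in (X < _)%E]GE.
pose H (y : R) : \bar R := ((5 * m)%:E * ((oneDsqr y)^-1)%:E)%E.
have mV : measurable_fun D0 (fun y : R => ((oneDsqr y)^-1)%:E).
  apply/measurable_EFinP; apply: measurable_funTS.
  by apply: continuous_measurable_fun => x; exact: continuous_oneDsqrV.
apply: (@le_lt_trans _ _ (\int[leb]_(y in D0) H y)%E).
  apply: ge0_le_integral => //; first exact: measurable_funeM.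
  move=> y; rewrite /D0 /= in_itv /= andbT le_eqVlt => /orP[/eqP <-|y0].
    by rewrite /G expr0n /= invr0 mul0e mule_ge0// lee_fin ?invr_ge0 ?mulr_ge0.
  have y2 : 0 < y ^+ 2 by rewrite exprn_gt0.
  have d0 : 0 < 1 + y ^+ 2 by rewrite ltr_wpDl.
  rewrite /G /H /oneDsqr -EFinM; have [yle|ygt] := leP y (1 / 2).
    apply: (@le_trans _ _ ((y ^- 2)%:E * (m * (4 * y ^+ 2))%:E)%E).
      by rewrite lee_pmul2l ?lte_fin ?invr_gt0//; exact: h2.
    rewrite -EFinM lee_fin ler_pdivlMr//.
    have -> : y ^- 2 * (m * (4 * y ^+ 2)) * (1 + y ^+ 2) = m * (4 * (1 + y ^+ 2)).
      by field; rewrite gt_eqF.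
    rewrite (mulrC 5) ler_wpM2l//; nra.
  apply: (@le_trans _ _ ((y ^- 2)%:E * m%:E)%E).
    by rewrite lee_pmul2l ?lte_fin ?invr_gt0//; exact: h1.
  rewrite -EFinM lee_fin ler_pdivlMr// mulrAC mulrC (mulrC 5) ler_wpM2l//.
  by rewrite mulrC ler_pdivrMr//; nra.
rewrite ge0_integralZl//.
- by rewrite integral0y_oneDsqr -EFinM ltry.
- by rewrite lee_fin mulr_ge0.
Qed.

End Area.

Section PolygonArea.
Variables (R : realType) (n : nat).
Hypothesis n_gt0 : (0 < n)%N.
Local Notation leb := (@lebesgue_measure R).
Local Notation Gamma := (@polygon_group R n).
Local Notation side := (@side R n).

Lemma polygon_upper_half : polygon n `<=` @upper_half_plane R.
Proof. by move=> z []. Qed.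

Lemma measurable_side_ge0 e (g : PSL2 R) :
  measurable [set p : R * R | 0 <= side e (gact g (point_of_H (p.1 +i* p.2)%C))].
Proof.
have [a [b [c lin]]] := side_gact_linear e g.
have := measurable_form_ge0 a b 0 c; congr measurable.
by apply/seteqP; split => p /=; rewrite lin /= mul0r addr0 mulr1.
Qed.

Lemma measurable_polygon_translate (g : PSL2 R) :
  measurable (plane_set [set z | 0 < complex.Im z /\
    forall e, 0 <= side e (gact g (point_of_H z))]).
Proof.
have -> : plane_set [set z | 0 < complex.Im z /\
    forall e, 0 <= side e (gact g (point_of_H z))] = [set p : R * R | 0 < p.2] `&`
    \bigcap_(e in setT)
      [set p : R * R | 0 <= side e (gact g (point_of_H (p.1 +i* p.2)%C))].
  by apply/seteqP; split => [p [p0 h]|p [p0 h]]; split => // e; [move=> _; exact: h|exact: h].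
apply: measurableI; first exact: measurable_upper_half.
apply: fin_bigcap_measurable; first exact: finite_finset.
by move=> e _; exact: measurable_side_ge0.
Qed.

Lemma measurable_polygon : measurable (plane_set (@polygon R n)).
Proof.
have := measurable_polygon_translate 1%g; congr measurable.
by apply/seteqP; split => p [p0 h]; split => // e; have := h e; rewrite gact1.
Qed.

(** By ping-pong the overlap lies on the edge named by the first letter. *)
Lemma polygon_overlap (g : PSL2 R) : Gamma g -> g <> 1%g ->
  hyp_area (act g @` polygon n `&` polygon n) = 0%E.
Proof.
move=> Gg g1; have [//|[e [l [rl eg]]]] := polygon_group_elim n_gt0 Gg.
have H1 : act g @` polygon n `&` polygon n `<=` @upper_half_plane R.
  by move=> z [_ []].
have [a [b [c [ab lin]]]] : exists a b c, (a != 0) || (b != 0) /\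
    forall p : R * R * R, side e p = a * p.1.1 + b * p.1.2 + c * p.2.
  case: e {eg rl} => [[j|]|] /=.
  - exists 1, (- (2 * j%:R + 1)), (j%:R * (j%:R + 1)).
    by rewrite oner_eq0; split=> // p; ring.
  - by exists 0, (-1), n%:R; rewrite oppr_eq0 oner_eq0 orbT; split=> // p; ring.
  - by exists 0, 1, 0; rewrite oner_eq0 orbT; split=> // p; ring.
apply: (@null_circle _ _ a b c) => //.
  have := measurableI _ _ (measurable_polygon_translate g^-1%g) measurable_polygon.
  congr measurable; apply/seteqP; split => p [h1 Pp]; split; try exact: Pp.
    case: h1 => p0 h; have p0' : 0 < complex.Im (p.1 +i* p.2)%C by [].
    have [q0 [k k0 ek]] := gact_point_of_H g^-1%g p0'.
    exists (act g^-1%g (p.1 +i* p.2)%C); last by rewrite -actM// mulgV act1.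
    by split => // f; have := h f; rewrite ek side_scale3 pmulr_rge0.
  case: h1 => z [z0 zP] ez; split; first by case: Pp.
  have [q0 [k k0 ek]] := gact_point_of_H g z0.
  move=> f; rewrite -[(_ +i* _)%C]ez -(pmulr_rge0 _ k0) -side_scale3 -gact_scale3 -ek.
  by rewrite -gactM mulVg gact1; exact: zP.
move=> z [[w [w0 wP] ewz] [z0 zP]].
have -> : a * (complex.Re z ^+ 2 + complex.Im z ^+ 2) + b * complex.Re z + c =
  side e (point_of_H z) by rewrite lin /= mulr1.
apply/eqP; rewrite eq_le zP andbT.
have [q0 [k k0 ek]] := gact_point_of_H g w0.
rewrite -ewz -(pmulr_rle0 _ k0) -side_scale3 -ek eg.
by apply: pingpong => //; exact: cone_point_of_H.
Qed.

Definition slice_cover (y : R) (j : nat) : set R :=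
  [set` `[j%:R, j%:R + 2 * y ^+ 2]] `|` [set` `[j%:R + 1 - 2 * y ^+ 2, j%:R + 1]].

Lemma slice_sub_itv y :
  ysection (plane_set (@polygon R n)) y `<=` [set` `[0, n%:R]].
Proof.
move=> x; rewrite /ysection /= inE => -[_ /= h].
have x0 := h None; have xn := h (Some None); rewrite /= in x0 xn.
by rewrite in_itv /= x0 /=; move: xn; rewrite mulr1 subr_ge0.
Qed.

Lemma unit_interval_of (x : R) : 0 <= x <= n%:R ->
  exists2 j : 'I_n, j%:R <= x & x <= j%:R + 1.
Proof.
move=> /andP[x0 xn]; case: n n_gt0 xn => // m _.
elim: m => [|m IH] xm; first by exists ord0; rewrite ?add0r.
have [/IH[j jx xj]|xgt] := leP x m.+1%:R; first by exists (widen_ord (leqnSn _) j).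
by exists ord_max; rewrite /= ?natr1// ltW.
Qed.

(** Near height [y] the polygon only reaches within [2 y ^ 2] of the vertical
    lines through its vertices. *)
Lemma slice_sub_cover y :
  ysection (plane_set (@polygon R n)) y `<=` \bigcup_(j < n) slice_cover y j.
Proof.
move=> x Sx; have [j jx xj] := unit_interval_of (slice_sub_itv Sx).
move: Sx; rewrite /ysection /= inE => -[_ /= /(_ (Some (Some j)))] /= h.
exists (val j); first exact: (ltn_ord j).
rewrite /slice_cover /= !in_itv /=.
have {h} h : (x - j%:R) * (j%:R + 1 - x) <= y ^+ 2 by rewrite -subr_ge0; lra.
have [xh|xh] := leP (x - j%:R) (1 / 2); [left|right]; apply/andP; split => //.
  by rewrite -lerBlDl; nra.
by nra.
Qed.

Lemma polygon_finite_area : (hyp_area (@polygon R n) < +oo)%E.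
Proof.
have mS y : measurable (ysection (plane_set (@polygon R n)) y).
  by apply: measurable_ysection; exact: measurable_polygon.
apply: (@finite_slices _ (@polygon R n) n%:R) => //.
- exact: polygon_upper_half.
- exact: measurable_polygon.
- move=> y y0; apply: (@le_trans _ _ (leb [set` `[0, n%:R]])).
    by apply: le_measure; rewrite ?inE//; [exact: mS|exact: slice_sub_itv].
  by rewrite lebesgue_measure_itv /= lte_fin ltr0n n_gt0 oppr0 adde0.
- move=> y y0; have y2 : 0 < y ^+ 2 by rewrite exprn_gt0.
  have mC j : measurable (slice_cover y j) by apply: measurableU; exact: measurable_itv.
  apply: (@le_trans _ _ (leb (\big[setU/set0]_(j < n) slice_cover y j))).
    apply: le_measure; rewrite ?inE//; first exact: mS.
      by apply: bigsetU_measurable => j _; exact: mC.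
    by rewrite -bigcup_mkord; exact: slice_sub_cover.
  apply: (le_trans (Boole_inequality _ _)); first by move=> j _; exact: mC.
  apply: (@le_trans _ _ (\sum_(j < n) (4 * y ^+ 2)%:E)%E); last first.
    rewrite sumEFin sumr_const card_ord. by rewrite -[_ *+ n]mulr_natl lexx.
  apply: lee_sum => j _.
  have len (a b : R) : a <= b -> leb [set` `[a, b]] = (b - a)%:E.
    rewrite lebesgue_measure_itv /= lte_fin le_eqVlt => /orP[/eqP->|->//].
    by rewrite ltxx subrr.
  pose lo : set R := [set` `[j%:R, j%:R + 2 * y ^+ 2]].
  pose hi : set R := [set` `[j%:R + 1 - 2 * y ^+ 2, j%:R + 1]].
  apply: (@le_trans _ _ (leb lo + leb hi)%E).
    by apply: measureU2; exact: measurable_itv.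
  by rewrite /lo /hi !len -?EFinD ?lee_fin; lra.
Qed.

Lemma polygon_fundamental : fundamental_domain Gamma (@polygon R n).
Proof.
split; [exact: polygon_upper_half|exact: measurable_polygon| |exact: polygon_overlap].
move=> z z0; have [g Gg Pg] := @polygon_covers R n n_gt0 z z0.
exists g^-1%g; first exact: polygon_groupV.
by exists (act g z) => //; rewrite -actM// mulVg act1.
Qed.

End PolygonArea.

(** * Commensurability *)

Section CommensurablePowers.
Variable gT : groupType.
Implicit Types (G : set gT) (x y : gT).

(** Pigeonhole: two distinct powers of the conjugate of [y] lie in the same coset
    of the common subgroup, so that some positive power lies in it. *)
Lemma commensurable_power G1 G2 y : is_subgroup G1 -> G2 1%g ->
  commensurable G1 G2 -> G1 y ->
  exists x k, (0 < k)%N /\ G2 (x * y ^+ k * x^-1)%g.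
Proof.
move=> [G11 G1M G1V] G21 [x [fin _]] Gy; set K := conj_subgroup x G1 `&` G2 in fin.
have GX k : G1 (y ^+ k)%g by elim: k => [|k IH]; rewrite ?expg0 ?expgS//; exact: G1M.
pose z := (x * y * x^-1)%g.
pose f (i : nat) : set gT := [set (z ^+ i * k)%g | k in K].
have K1 : K 1%g by split => //; exists 1%g => //; rewrite mulg1 mulgV.
have step i j : (i < j)%N -> f i = f j -> exists x k, (0 < k)%N /\ G2 (x * y ^+ k * x^-1)%g.
  move=> ij fij; exists x, (j - i)%N; rewrite subn_gt0 ij; split => //.
  have : f i (z ^+ j)%g by rewrite fij; exists 1%g; rewrite ?mulg1.
  case=> k [_ Gk] ek; suff <- : k = (x * y ^+ (j - i) * x^-1)%g by [].
  apply: (mulgI (z ^+ i)%g); rewrite ek -conj_power -/z.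
  by rewrite -{1}(subnKC (ltnW ij)) expgnDr.
have [inj|] := pselect (injective f).
  exfalso; apply: infinite_nat.
  rewrite -(eq_finite_set (inj_card_eq (in2W inj))); apply: sub_finite_set fin.
  move=> _ [i _ <-]; exists (z ^+ i)%g => //.
  by exists (y ^+ i)%g => //; rewrite conj_power.
move=> /existsNP[i /existsNP[j /not_implyP[fij ij]]].
by have [lij|lji|//] := ltngtP i j; [exact: step lij fij|exact: step lji (esym fij)].
Qed.

Lemma commensurable_refl G : is_subgroup G -> commensurable G G.
Proof.
move=> [G1 GM GV]; exists 1%g.
have -> : conj_subgroup 1%g G = G.
  apply/seteqP; split => [_ [y Gy <-]|y Gy]; first by rewrite mul1g invg1 mulg1.
  by exists y => //; rewrite mul1g invg1 mulg1.
rewrite setIid; suff : has_finite_index G G by [].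
apply: (sub_finite_set _ (finite_set1 G)) => _ [x Gx <-] /=.
apply/seteqP; split => [_ [y Gy <-]|y Gy]; first exact: GM.
by exists (x^-1 * y)%g; rewrite ?mulgA ?mulgV ?mul1g//; apply: GM => //; exact: GV.
Qed.

End CommensurablePowers.

Section Denominators.
Variable R : realType.
Implicit Types (G : set (PSL2 R)).

(** The squared traces of such a group are integers divided by powers of [r]. *)
Definition denominators_from (r : nat) G := forall g, G g ->
  exists (B : 'M[int]_2) k, \det B = (r ^ k)%N /\ g = psl (map_mx intr B).

Lemma PSL2Z_denominators : denominators_from 1 (@PSL2Z R).
Proof.
move=> _ [B [A [dB eA ->]]]; exists B, 0%N; split => //.
rewrite -eA /psl SL2P sqrtr1 invr1 scale1r; congr toPSL2.
by apply/esym; exact: valKd.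
Qed.

Lemma PSL2Z1 : @PSL2Z R 1%g.
Proof.
exists 1%:M, 1%g; split; [exact: det1|by rewrite map_mx1|].
by [].
Qed.

(** Modulo p the matrix of this hyperbolic element is [(0, 0; 1, -1)], so the
    traces of its powers are prime to p although the determinants are not. *)
Lemma power_trace (p : nat) (p_pr : prime p) k : (0 < k)%N ->
  exists B : 'M[int]_2, [/\ \det B = (p ^ k)%N,
    (psl (mx2 (- (2 * p%:R)) p%:R 1 (-1) : 'M[R]_2) ^+ k)%g = psl (map_mx intr B) &
    ~~ (p %| \tr B)%Z].
Proof.
move=> k_gt0; pose B1 : 'M[int]_2 := mx2 (- (2 * p%:Z)) p%:Z 1 (-1).
have p_gt0 := prime_gt0 p_pr.
have eB1 : map_mx intr B1 = mx2 (- (2 * p%:R)) p%:R 1 (-1) :> 'M[R]_2.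
  by rewrite [LHS]mx2_eta !mxE; congr mx2; rewrite ?rmorphN ?rmorphM /= -?pmulrn.
rewrite -eB1.
have dB1 : \det B1 = p by rewrite det2; lra.
suff [B [dB eB d01 nd11 /(_ k_gt0) d00]] : exists B : 'M[int]_2, [/\ \det B = (p ^ k)%N,
    (psl (map_mx intr B1 : 'M[R]_2) ^+ k)%g = psl (map_mx intr B),
    (p %| (B 0 1)%R)%Z, ~~ (p %| (B 1 1)%R)%Z & ((0 < k)%N -> (p %| (B 0 0)%R)%Z)].
  by exists B; split => //; rewrite tr2E rpredDl.
elim: k {k_gt0} => [|k [B [dB eB d01 nd11 _]]].
  exists 1%:M; rewrite det1 map_mx1 psl1 expg0 !mxE /=; split => //.
  by rewrite dvdzE /= dvdn1 gtn_eqF ?prime_gt1.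
have dBR : 0 < \det (map_mx intr B : 'M[R]_2).
  by rewrite det_map_mx dB /= -pmulrn ltr0n expn_gt0 p_gt0.
exists (B1 *m B); rewrite !mulmx2E !mx2E; split.
- by rewrite det_mulmx dB1 dB expnS PoszM.
- rewrite expgS eB map_mxM pslM//.
  by rewrite det_map_mx dB1 /= -pmulrn ltr0n.
- by apply: rpredD; [exact: dvdz_mull|exact: dvdz_mulr].
- by rewrite mul1r mulN1r rpredDl// rpredN.
- by move=> _; apply: rpredD; apply: dvdz_mulr; rewrite ?rpredN// dvdz_mull.
Qed.

(** Squared traces are invariant under conjugation, and those of the powers of
    the element of [power_trace] have a power of p as denominator, which [r]
    prime to p rules out. *)
Lemma polygon_group_not_commensurable (p r : nat) G : prime p -> coprime p r ->
  (0 < r)%N -> G 1%g -> denominators_from r G ->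
  ~ commensurable (@polygon_group R p) G.
Proof.
move=> p_pr pr r_gt0 G1 denG com; have p_gt0 := prime_gt0 p_pr.
pose y : PSL2 R := psl (mx2 (- (2 * p%:R)) p%:R 1 (-1)).
have Gy : polygon_group p y.
  have -> : y = (gen R (None : edge p) * gen R (Some (Some (Ordinal p_gt0))))%g.
    by rewrite -pslM ?det_gen_gt0//; congr psl; rewrite mulmx2 /=; congr mx2; ring.
  by apply: polygon_groupM => //; exact: gen_in.
have [x [k [k_gt0 Gk]]] := commensurable_power (polygon_group_subgroup R p_gt0) G1 com Gy.
have [B [dB eB trB]] := power_trace p_pr k_gt0.
have [C [l [dC eC]]] := denG _ Gk.
have pk : 0 < (p ^ k)%N%:R :> R by rewrite ltr0n expn_gt0 p_gt0.
have rl : 0 < (r ^ l)%N%:R :> R by rewrite ltr0n expn_gt0 r_gt0.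
have trE (M : 'M[int]_2) (m : nat) : \det M = m -> 0 < m%:R :> R ->
    trace_sqr (psl (map_mx intr M : 'M[R]_2)) = (\tr M ^+ 2)%:~R / m%:R.
  move=> dM m0; have dMR : \det (map_mx intr M : 'M[R]_2) = m%:R.
    by rewrite det_map_mx dM /= -pmulrn.
  by rewrite trace_sqr_psl dMR// rmorphXn /= trace_map_mx.
have : trace_sqr (x * y ^+ k * x^-1)%g = trace_sqr (y ^+ k)%g by exact: trace_sqr_conj.
rewrite eC (trE _ _ dC rl) eB (trE _ _ dB pk) => /eqP.
rewrite eqr_div ?lt0r_neq0// !pmulrn -!intrM eqr_int => /eqP e.
have : (p %| \tr B ^+ 2 * (r ^ l)%N)%Z.
  by rewrite -e dvdz_mull// dvdzE /= dvdn_exp.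
rewrite dvdzE abszM abszX Euclid_dvdM// Euclid_dvdX// -dvdzE (negPf trB) /=.
by rewrite Euclid_dvdX//; move: pr; rewrite prime_coprime// => /negPf ->.
Qed.

Lemma polygon_group_denominators (r : nat) : prime r ->
  denominators_from r (@polygon_group R r).
Proof. by move=> /prime_gt0 r_gt0 g; exact: polygon_group_integral. Qed.

Lemma polygon_group_fuchsian (p : nat) : prime p -> fuchsian (@polygon_group R p).
Proof.
move=> /prime_gt0 p_gt0.
by split; [exact: polygon_group_subgroup|exact: polygon_group_discrete].
Qed.

Lemma polygon_group_pseudomodular (p : nat) : prime p ->
  pseudomodular_group (@polygon_group R p).
Proof.
move=> p_pr; have p_gt0 := prime_gt0 p_pr; split.
- exact: polygon_group_PGL2Q.
- exact: polygon_group_fuchsian.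
- exists (@polygon R p); [exact: polygon_fundamental|exact: polygon_finite_area].
- apply: (@polygon_group_not_commensurable p 1) => //; first exact: coprimen1.
    exact: PSL2Z1.
  exact: PSL2Z_denominators.
- exact: polygon_group_cusps.
Qed.

Lemma polygon_groups_incommensurable (p r : nat) : prime p -> prime r ->
  commensurable (@polygon_group R p) (@polygon_group R r) -> p = r.
Proof.
move=> p_pr r_pr com; apply/eqP/negPn/negP=> pr.
apply: (@polygon_group_not_commensurable p r _ p_pr _ _ _ _ com).
- by rewrite prime_coprime// dvdn_prime2.
- exact: prime_gt0.
- exact/polygon_group1/prime_gt0.
- exact: polygon_group_denominators.
Qed.

End Denominators.

(** * Surfaces determine their groups *)

Section Orbits.
Variable R : realType.
Implicit Types (G : set (PSL2 R)) (g h : PSL2 R).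

(** Two fixed points in the half plane, taken at height 1 to simplify the
    equations, force an isometry to be trivial. *)
Lemma act_fixed_line g (s t : R) : s != t ->
  act g (s +i* 1)%C = (s +i* 1)%C -> act g (t +i* 1)%C = (t +i* 1)%C -> g = 1%g.
Proof.
move=> st gs gt.
have fix_eq (u : R) : act g (u +i* 1)%C = (u +i* 1)%C -> let A := val (repr g) in
    A 0 0 * u + A 0 1 = u * (A 1 0 * u + A 1 1) - A 1 0 /\
    A 0 0 = u * A 1 0 + (A 1 0 * u + A 1 1).
  move=> + A; rewrite /act /mobius -/A; set N := (X in X / _); set D := (X in _ / X).
  have [->|D0] := eqVneq D 0.
    by rewrite invr0 mulr0 => /eqP; rewrite eq_complex /= [0 == 1]eq_sym oner_eq0 andbF.
  move=> /(congr1 (fun z => z * D)); rewrite divfK// /N /D => /eqP.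
  by rewrite eq_complex /= => /andP[/eqP e1 /eqP e2]; split; lra.
have := det_repr g; rewrite det2E => dA.
have [e1 e2] := fix_eq s gs; have [e3 e4] := fix_eq t gt.
have c0 : val (repr g) 1 0 = 0.
  apply/eqP; have : (s - t) * (2 * val (repr g) 1 0) = 0 by lra.
  by move/eqP; rewrite mulf_eq0 subr_eq0 (negPf st) mulf_eq0 pnatr_eq0.
have ad : val (repr g) 0 0 = val (repr g) 1 1 by rewrite e2 c0; ring.
have b0 : val (repr g) 0 1 = 0 by move: e1; rewrite c0 ad; lra.
rewrite -[g]psl_repr [val (repr g)]mx2_eta c0 b0 ad; apply: psl_scalar.
apply/eqP=> d0; move: dA; rewrite c0 d0 mulr0 mulr0 subrr => /esym/eqP.
by rewrite oner_eq0.
Qed.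

(** Two distinct isometries agree in at most one point, so if [g] agreed at each
    point of the line Im z = 1 with an element of [G] other than [g], then [G]
    would be uncountable. *)
Lemma countable_group_orbits G g : countable G ->
  is_subgroup G ->
  (forall z, @upper_half_plane R z -> exists2 h, G h & act g z = act h z) -> G g.
Proof.
move=> cG [G1 GM GV] orb; apply: contrapT => nGg.
have H1 (t : R) : @upper_half_plane R (t +i* 1)%C by exact: ltr01.
have /choice[h hP] (t : R) : exists h, G h /\ act g (t +i* 1)%C = act h (t +i* 1)%C.
  by have [h Gh e] := orb _ (H1 t); exists h.
have injh : injective h.
  move=> s t est; apply/eqP/negPn/negP => st; apply: nGg.
  have fix1 (u : R) : act ((h u)^-1 * g)%g (u +i* 1)%C = (u +i* 1)%C.
    have [_ e] := hP u; have u1 := H1 u : 0 < complex.Im _.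
    by rewrite actM// e -actM// mulVg act1.
  have : ((h s)^-1 * g)%g = 1%g.
    by apply: (act_fixed_line st); [exact: fix1|rewrite est; exact: fix1].
  move=> /(congr1 (fun x => h s * x)%g); rewrite mulgA mulgV mul1g mulg1 => ->.
  by case: (hP s).
have : countable [set: R].
  rewrite -(eq_countable (inj_card_eq (in2W injh))).
  by apply: sub_countable cG; apply: subset_card_le => _ [t _ <-]; case: (hP t).
move=> /countable_lebesgue_measure0.
by have := lebesgue_measure_itv (`]-oo, +oo[ : interval R); rewrite set_itvE /= => ->.
Qed.

Lemma quotient_surface_orbits G1 G2 g z : is_subgroup G1 -> is_subgroup G2 ->
  quotient_surface G1 = quotient_surface G2 -> G1 g -> @upper_half_plane R z ->
  exists2 h, G2 h & act g z = act h z.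
Proof.
move=> [G11 G1M G1V] [G21 G2M G2V] e12 Gg z0.
have : quotient_surface G2 [set act h z | h in G1] by rewrite -e12; exists z.
case=> w w0 eorb.
have [h0 Gh0 e0] : [set act h w | h in G2] z.
  by rewrite eorb; exists 1%g => //; exact: act1.
have [h1 Gh1 e1] : [set act h w | h in G2] (act g z) by rewrite eorb; exists g.
exists (h1 * h0^-1)%g; first exact/G2M/G2V.
by rewrite -[in RHS]e0 -actM// -mulgA mulVg mulg1 e1.
Qed.

(** The countability of [G1] passes to [G2] once [G2] is known to be contained in
    [G1], and then the roles can be exchanged. *)
Lemma quotient_surface_inj G1 G2 : countable G1 -> is_subgroup G1 -> is_subgroup G2 ->
  quotient_surface G1 = quotient_surface G2 -> G1 = G2.
Proof.
move=> c1 s1 s2 e12; have sub21 : G2 `<=` G1.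
  move=> g Gg; apply: countable_group_orbits => // z z0.
  exact: (quotient_surface_orbits s2 s1 (esym e12) Gg z0).
apply/seteqP; split => // g Gg; apply: countable_group_orbits => //.
  by apply: sub_countable c1; exact: subset_card_le.
by move=> z z0; exact: (quotient_surface_orbits s1 s2 e12 Gg z0).
Qed.

Lemma polygon_group_countable n : countable (@polygon_group R n).
Proof. exact: sub_countable (card_image_le _ _) (countableP _). Qed.

End Orbits.

(** * Infinitely many classes *)

Lemma infinite_primes : infinite_set [set p : nat | prime p].
Proof.
move=> /finite_seqP[s es]; have [p ps p_pr] := prime_above (\max_(x <- s) x).
have : [set` s] p by rewrite -es.
by move=> /= sp; have := @leq_bigmax_seq nat s predT id p sp isT; rewrite leqNgt ps.
Qed.

Lemma infinite_prime_family (T : Type) (F : nat -> T) (A : set T) :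
  (forall p, prime p -> A (F p)) ->
  (forall p r, prime p -> prime r -> F p = F r -> p = r) -> infinite_set A.
Proof.
move=> FA Finj /(sub_finite_set (A := F @` [set p | prime p])) fin.
apply: infinite_primes; rewrite -(eq_finite_set (@inj_card_eq _ _ _ F _)).
  by apply: fin => _ [p p_pr <-]; exact: FA.
by move=> p r; rewrite !inE; exact: Finj.
Qed.

Theorem theorem1p2 (R : realType) :
  infinite_set [set pseudomodular_group_class G
               | G in [set G : set (PSL2 R) | pseudomodular_group G]] /\
  infinite_set [set pseudomodular_surface_class X
               | X in [set X : set (set (complex R)) | pseudomodular_surface X]].
Proof.
pose Gam p : set (PSL2 R) := @polygon_group R p.
have psG p : prime p -> pseudomodular_group (Gam p) := @polygon_group_pseudomodular R p.
have fG p : prime p -> fuchsian (Gam p) := @polygon_group_fuchsian R p.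
have refl p : prime p -> commensurable (Gam p) (Gam p).
  by move=> /fG[sG _]; exact: commensurable_refl.
split.
  apply: (@infinite_prime_family _ (fun p => pseudomodular_group_class (Gam p))).
    by move=> p p_pr; exists (Gam p) => //; exact: psG.
  move=> p r p_pr r_pr epr.
  have [_ com] : pseudomodular_group_class (Gam p) (Gam r).
    by rewrite epr; split; [exact: psG|exact: refl].
  exact: polygon_groups_incommensurable com.
apply: (@infinite_prime_family _
  (fun p => pseudomodular_surface_class (quotient_surface (Gam p)))).
  move=> p p_pr; exists (quotient_surface (Gam p)) => //.
  by exists (Gam p) => //; exact: psG.
move=> p r p_pr r_pr epr.
have [_ [G1 [G2 [[[s1 _] e1] [[s2 _] e2] com]]]] :
    pseudomodular_surface_class (quotient_surface (Gam p)) (quotient_surface (Gam r)).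
  rewrite epr; split; first by exists (Gam r) => //; exact: psG.
  by exists (Gam r), (Gam r); split; [split; [exact: fG|]|split; [exact: fG|]|exact: refl].
have eq1 := quotient_surface_inj (polygon_group_countable R p) (fG p p_pr).1 s1 e1.
have eq2 := quotient_surface_inj (polygon_group_countable R r) (fG r r_pr).1 s2 e2.
by rewrite -eq1 -eq2 in com; exact: polygon_groups_incommensurable com.
Qed.
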